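(* There are only countably many non-Haar null conjugacy classes in $\mathrm{Homeo}^+([0,1])$.
   Context: $\mathrm{Homeo}^+([0,1])$ is the Polish group (under composition) of increasing homeomorphisms of $[0,1]$ with the topology of uniform convergence. Haar null sets (Christensen): in a Polish group $G$, a Borel set $B\subset G$ is Haar null if there is a Borel probability measure $\mu$ on $G$ such that $\mu(gBh)=0$ for all $g,h\in G$; an arbitrary set $S \subset G$ is Haar null if it is contained in a Borel Haar null set; a set is non-Haar null if it is not Haar null. *)

(* Defs.v *)
From HB Require Import structures.
From mathcomp Require Import all_boot all_order all_algebra.
From mathcomp Require Import all_classical all_reals all_analysis.

Set Implicit Arguments.
Unset Strict Implicit.
Unset Printing Implicit Defensive.

Import Order.TTheory GRing.Theory Num.Theory.
Import numFieldNormedType.Exports.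

Local Open Scope classical_set_scope.
Local Open Scope ring_scope.

(* The analysis library only has additive topological groups
   (topologicalZmodType); this is the multiplicative counterpart.  The point of
   PointedTopological is only required by g_sigma_algebraType. *)
HB.structure Definition PreTopologicalGroup :=
  {G of PointedTopological G & Group G}.

HB.mixin Record PreTopologicalGroup_isTopologicalGroup G
    & PreTopologicalGroup G := {
  mulg_continuous : continuous (fun x : G * G => (x.1 * x.2)%g);
  invg_continuous : continuous (fun x : G => (x^-1)%g)
}.

#[short(type="topologicalGroupType")]
HB.structure Definition TopologicalGroup :=
  {G of PreTopologicalGroup G & PreTopologicalGroup_isTopologicalGroup G}.

Section haar_null.
Variables (R : realType) (G : topologicalGroupType).

Definition borel : measurableType _ := g_sigma_algebraType (@open G).

(* These are Christensen's definitions; they use only the group operations and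
   the Borel sets, but are intended for a Polish group [G].  [R] is the type in
   which the measures take their values. *)
Definition borel_haar_null (B : set G) : Prop :=
  measurable (B : set borel) /\
  exists mu : probability borel R,
    forall g h : G, mu [set (g * x * h)%g | x in B] = 0%E.

Definition haar_null (S : set G) : Prop :=
  exists2 B : set G, borel_haar_null B & S `<=` B.

End haar_null.

Section conjugacy.
Variable G : groupType.

Definition conjugacy_class (x : G) : set G := [set (x ^ g)%g | g in [set: G]].

Definition conjugacy_classes : set (set G) := range conjugacy_class.

End conjugacy.


Lemma compact_unif_continuous (X : puniformType) (Y : uniformType)
    (f : X -> Y) :
  compact [set: X] -> continuous f -> unif_continuous f.
Proof.
move=> /compact_near_coveringP cX cf E entE.
suff [D entD DE] : exists2 D, @entourage X D &
    forall x y, D (x, y) -> E (f x, f y).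
  by apply: filterS entD => -[x y] /DE.
have := cX _ (powerset_filter_from (@entourage X))
  (fun D x => forall y, D (x, y) -> E (f x, f y)) _.
case; last first.
  move=> P [PE _ [D PD]] sP; exists D; first exact: PE.
  by move=> x y; exact: (sP _ PD x).
move=> x _.
pose S := split_ent E.
have entS : entourage S by exact: entourage_split_ent.
have := cf x _ (nbhs_entourage (f x) (entourage_invI entS)).
rewrite nbhs_simpl/= -nbhs_entourageE => -[D0 entD0 sD0].
have fD0 z : D0 (x, z) -> (S `&` S^-1)%relation (f x, f z).
  by move=> xz; apply/xsectionP; apply: sD0; exact/xsectionP.
exists (xsection (split_ent D0) x,
  [set D | entourage D /\ D `<=` split_ent D0]).
  split=> /=; first exact/nbhs_entourage/entourage_split_ent.
  apply: filterI; first exact: near_small_set.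
  exact/small_set_sub/entourage_split_ent.
move=> [x' D] [/= /xsectionP xx' [entD sD]] y /sD x'y.
have [_ Sx'] := fD0 _ (split_ent_subset entD0 xx').
have [Sy _] := fD0 _ (entourage_split x' entD0 xx' x'y).
exact: (entourage_split (f x) entE).
Qed.

Definition unit_interval (R : realType) : Type := set_type (`[0, 1]%classic : set R).

HB.instance Definition _ (R : realType) :=
  PseudoMetric.copy (unit_interval R) (set_type (`[0, 1]%classic : set R)).

Fact unit_interval0_subproof (R : realType) : (0 : R) \in (`[0, 1]%classic : set R).
Proof. by rewrite inE/= in_itv/= lexx ler01. Qed.

HB.instance Definition _ (R : realType) :=
  isPointed.Build (unit_interval R) (exist _ 0 (unit_interval0_subproof R)).

Definition increasing_homeo (R : realType) :
    set {uniform unit_interval R -> unit_interval R} :=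
  [set f : unit_interval R -> unit_interval R |
    [/\ continuous f,
        exists2 g : unit_interval R -> unit_interval R,
          continuous g & cancel f g /\ cancel g f &
        {homo f : x y / sval x < sval y}]].

(* As a subtype of [{uniform _ -> _}], it carries the topology of uniform
   convergence. *)
Definition homeo01 (R : realType) : Type := set_type (@increasing_homeo R).

HB.instance Definition _ (R : realType) :=
  Uniform.copy (homeo01 R) (set_type (@increasing_homeo R)).

Section homeo01_group.
Variable R : realType.
Local Notation I := (unit_interval R).
Implicit Types f g h : homeo01 R.

Lemma unit_interval_compact : compact [set: I].
Proof.
pose c (x : R) : I := insubd (point : I) x.
have cK (x : I) : c (sval x) = x.
  by apply: val_inj; rewrite val_insubd; case: x => x /= ->.
have -> : [set: I] = c @` `[0, 1]%classic.
  apply/seteqP; split=> // x _; exists (sval x) => //.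
  by case: x => x /= /set_mem.
apply: continuous_compact; last exact: segment_compact.
apply/subspace_sigL_continuousP.
rewrite (_ : sigL _ _ = idfun); last by apply/funext => x; exact: cK.
by move=> x; exact: cvg_id.
Qed.

Definition homeo01_fun f : I -> I := sval f.

Definition Homeo01 (f : I -> I) (fP : increasing_homeo f) : homeo01 R :=
  exist (fun u : {uniform I -> I} => u \in @increasing_homeo R) f (mem_set fP).

Lemma homeo01P f : increasing_homeo (homeo01_fun f).
Proof. by case: f => f /= /set_mem. Qed.

Lemma homeo01_eq f g : homeo01_fun f =1 homeo01_fun g -> f = g.
Proof. by move=> fg; apply: eq_sig_hprop => //; exact/funext. Qed.

Fact homeo01_one_subproof : @increasing_homeo R (idfun : I -> I).
Proof.
split=> //; first by move=> x; exact: cvg_id.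
by exists idfun => // x; exact: cvg_id.
Qed.

Definition homeo01_one : homeo01 R := Homeo01 homeo01_one_subproof.

Fact homeo01_mul_subproof f g :
  increasing_homeo (homeo01_fun f \o homeo01_fun g : I -> I).
Proof.
have [cf [f' cf' [fK f'K]] mf] := homeo01P f.
have [cg [g' cg' [gK g'K]] mg] := homeo01P g.
split.
- by move=> x; apply: continuous_comp; [exact: cg|exact: cf].
- exists (g' \o f').
    by move=> x; apply: continuous_comp; [exact: cf'|exact: cg'].
  by split; apply: can_comp.
- by move=> x y /mg /mf.
Qed.

Definition homeo01_mul f g : homeo01 R := Homeo01 (homeo01_mul_subproof f g).

Fact homeo01_inv_subproof f : exists g,
  cancel (homeo01_fun f) (homeo01_fun g) /\ cancel (homeo01_fun g) (homeo01_fun f).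
Proof.
have [cf [f' cf' [fK f'K]] mf] := homeo01P f.
have f'P : increasing_homeo (f' : I -> I).
  split=> //; first by exists (homeo01_fun f).
  move=> x y xy; rewrite ltNge le_eqVlt; apply/negP => /predU1P[yx|/mf].
    by move/val_inj : yx => /(can_inj f'K) yx; rewrite yx ltxx in xy.
  by rewrite !f'K ltNge (ltW xy).
by exists (Homeo01 f'P).
Qed.

Definition homeo01_inv f : homeo01 R := projT1 (cid (homeo01_inv_subproof f)).

Lemma homeo01_invK f : cancel (homeo01_fun f) (homeo01_fun (homeo01_inv f)).
Proof. by rewrite /homeo01_inv; case: cid => g []. Qed.

Lemma homeo01_invKV f : cancel (homeo01_fun (homeo01_inv f)) (homeo01_fun f).
Proof. by rewrite /homeo01_inv; case: cid => g []. Qed.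

Fact homeo01_mulA : associative homeo01_mul.
Proof. by move=> f g h; exact: homeo01_eq. Qed.

Fact homeo01_mul1 : left_id homeo01_one homeo01_mul.
Proof. by move=> f; exact: homeo01_eq. Qed.

Fact homeo01_1mul : right_id homeo01_one homeo01_mul.
Proof. by move=> f; exact: homeo01_eq. Qed.

Fact homeo01_mulV : left_inverse homeo01_one homeo01_inv homeo01_mul.
Proof. by move=> f; apply: homeo01_eq => x; exact: homeo01_invK. Qed.

Fact homeo01_Vmul : right_inverse homeo01_one homeo01_inv homeo01_mul.
Proof. by move=> f; apply: homeo01_eq => x; exact: homeo01_invKV. Qed.

HB.instance Definition _ := isPointed.Build (homeo01 R) homeo01_one.

HB.instance Definition _ := isGroup.Build (homeo01 R)
  homeo01_mulA homeo01_mul1 homeo01_1mul homeo01_mulV homeo01_Vmul.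

Lemma homeo01_nbhsP f (P : set (homeo01 R)) :
  nbhs f P <-> exists2 E, entourage E &
    [set g | forall x, E (homeo01_fun f x, homeo01_fun g x)] `<=` P.
Proof.
split.
- rewrite -nbhs_entourageE => -[W [V entV sV] VP].
  move: entV; rewrite uniform_entourage => -[E entE EV].
  exists E => // g Eg; apply: VP; apply/xsectionP; apply: sV; apply: EV => t _.
  exact: Eg.
- move=> [E entE EP]; rewrite -nbhs_entourageE.
  exists [set fg | forall x, E (homeo01_fun fg.1 x, homeo01_fun fg.2 x)].
    exists [set uv | forall x, E (uv.1 x, uv.2 x)] => //.
    by rewrite uniform_entourage; exists E => // -[u v] /= uv x; exact: uv.
  by move=> g /xsectionP; exact: EP.
Qed.

Lemma homeo01_unif_continuous f : unif_continuous (homeo01_fun f).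
Proof.
apply: compact_unif_continuous; first exact: unit_interval_compact.
by have [] := homeo01P f.
Qed.

Fact homeo01_mul_continuous :
  continuous (fun fg : homeo01 R * homeo01 R => (fg.1 * fg.2)%g).
Proof.
move=> [f g] P /= /homeo01_nbhsP[E entE EP].
have entS := entourage_split_ent entE.
pose D := [set xy | split_ent E (homeo01_fun f xy.1, homeo01_fun f xy.2)].
have entD : entourage D by exact: homeo01_unif_continuous entS.
exists ([set f' | forall x, split_ent E (homeo01_fun f x, homeo01_fun f' x)],
        [set g' | forall x, D (homeo01_fun g x, homeo01_fun g' x)]) => /=.
  by split; apply/homeo01_nbhsP; [exists (split_ent E)|exists D].
move=> [f' g'] /= [ff' gg']; apply: EP => x /=.
by apply: (entourage_split (homeo01_fun f (homeo01_fun g' x))) => //; exact: gg'.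
Qed.

Fact homeo01_inv_continuous : continuous (fun f : homeo01 R => (f^-1)%g).
Proof.
move=> f P /= /homeo01_nbhsP[E entE EP].
have entD := homeo01_unif_continuous (f^-1)%g (entourage_inv entE).
apply/homeo01_nbhsP; eexists; first exact: entD.
move=> g /= fg; apply: EP => y /=; have := fg (homeo01_fun (g^-1)%g y).
by rewrite /= homeo01_invK homeo01_invKV.
Qed.

HB.instance Definition _ := PreTopologicalGroup_isTopologicalGroup.Build
  (homeo01 R) homeo01_mul_continuous homeo01_inv_continuous.

End homeo01_group.

(* Main.v *)
(* Work with increasing bijections of the real line fixing the complement
   of (0, 1).  Call f good if its fixed points do not accumulate inside (0, 1)
   and f - id changes sign at each of them.  A good f is determined up to
   conjugacy by the order type of its set of fixed points in (0, 1) and by one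
   sign, hence good homeomorphisms fall into countably many conjugacy classes: on
   two components of the complement of the fixed points where the signs agree, a
   conjugacy is obtained by spreading an arbitrary map between fundamental
   domains over the orbits.

   It remains to see that the homeomorphisms which are not good form a Haar null
   set.  The witness is the law of the Moebius map
   phi_t(x) = t x / (1 + (t - 1) x), with t uniform in [1, 2].  With
   O(x) = x / (1 - x) one has O(phi_t(x)) = t O(x), so g phi_t h has a fixed point
   (resp. lies above the identity) at x iff t G(x) = K(x) (resp. >=), where
   G = O o h and K = O o g^-1 are increasing.  On a given interval
   there is at most one t for which t G touches K from above, resp. from below,
   and K / G has bounded variation on
   compact subintervals of (0, 1), so that by Banach's indicatrix argument almost
   all its levels are attained finitely often. *)

From mathcomp Require Import all_boot all_order all_algebra.
From mathcomp Require Import all_classical all_reals all_analysis.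
From mathcomp Require Import measurable_realfun ring lra zify.
Require Import Defs.

Set Implicit Arguments.
Unset Strict Implicit.
Unset Printing Implicit Defensive.

Import Order.TTheory GRing.Theory Num.Theory.
Import numFieldNormedType.Exports.

Local Open Scope classical_set_scope.
Local Open Scope ring_scope.

(** * Order automorphisms of the line and their orbits *)

Section order_automorphisms.
Variable R : realType.
Implicit Types (f g u d : R -> R) (e : int -> R) (x y z : R).

(** The inverse is an explicit argument, so that [order_autV] turns results on upward moving maps
    into results on downward moving ones. *)
Definition order_aut f f' :=
  [/\ {homo f : x y / x < y}, cancel f f' & cancel f' f].

Lemma order_aut_lt f f' : order_aut f f' -> {mono f : x y / x < y}.
Proof. by move=> [fh _ _]; apply: leW_mono; exact: le_mono. Qed.

Lemma order_aut_le f f' : order_aut f f' -> {mono f : x y / x <= y}.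
Proof. by move=> [fh _ _]; exact: le_mono. Qed.

Lemma order_autV f f' : order_aut f f' -> order_aut f' f.
Proof.
move=> fP; have [fh fK f'K] := fP; split=> // x y xy.
by rewrite -(order_aut_lt fP) !f'K.
Qed.

Lemma order_aut_id : order_aut id id.
Proof. by split. Qed.

Lemma order_aut_comp f f' g g' : order_aut f f' -> order_aut g g' ->
  order_aut (f \o g) (g' \o f').
Proof.
move=> [fh fK f'K] [gh gK g'K]; split; try exact: can_comp.
by move=> x y /gh /fh.
Qed.

Lemma order_aut_iter f f' n : order_aut f f' ->
  order_aut (iter n f) (iter n f').
Proof.
move=> fP; elim: n => [|n IH]; first exact: order_aut_id.
have := order_aut_comp fP IH; congr order_aut; apply/funext => x //=.
by rewrite -iterSr.
Qed.

Lemma iter_le f f' x n m : order_aut f f' -> x <= f x -> (n <= m)%N ->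
  iter n f x <= iter m f x.
Proof.
move=> fP xf; elim: m n => [|m IH] n; first by rewrite leqn0 => /eqP ->.
rewrite leq_eqVlt => /predU1P[->//|]; rewrite ltnS => /IH /le_trans; apply.
by rewrite iterSr (order_aut_le (order_aut_iter m fP)).
Qed.

(* The supremum of a bounded orbit is a fixed point. *)
Lemma orbit_exceeds f f' x y : order_aut f f' -> x < f x ->
  (forall z, x < z <= y -> f z != z) -> exists n, y < iter n f x.
Proof.
move=> fP xf nofix; apply/not_existsP => bnd.
have {}bnd n : iter n f x <= y by rewrite leNgt; apply/negP; exact: bnd.
pose A := [set iter n f x | n in [set: nat]].
have supA : has_sup A.
  split; first by exists x, 0%N.
  by exists y => _ [n _ <-].
have ubs n : iter n f x <= sup A by apply: ub_le_sup; [exact: supA.2|exists n].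
have xs : x < sup A by exact: lt_le_trans xf (ubs 1%N).
have sy : sup A <= y by apply: ge_sup => [|_ [n _ <-]]//; exact: supA.1.
have /eqP := nofix (sup A) ltac:(by rewrite xs sy); apply.
have [fh fK f'K] := fP.
apply/eqP; rewrite eq_le; apply/andP; split; last first.
  apply: ge_sup => [|_ [n _ <-]]; first exact: supA.1.
  by apply: le_trans (iter_le fP (ltW xf) (leqnSn n)) _; rewrite iterS (order_aut_le fP).
rewrite leNgt -(order_aut_lt (order_autV fP)) fK; apply/negP.
case/(sup_gt supA.1) => _ [n _ <-]; rewrite -(order_aut_lt fP) f'K.
by rewrite ltNge (ubs n.+1).
Qed.

(** By [lt_invE], [up f'] says that [f] lies below the identity; both signs are thus expressed with
    [up]. *)
Definition up f x y := forall z, x < z < y -> z < f z.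

Lemma lt_invE f f' x : order_aut f f' -> (x < f' x) = (f x < x).
Proof. by move=> fP; case: (fP) => _ _ f'K; rewrite -(order_aut_lt fP) f'K. Qed.

Lemma fix_inv f f' x : order_aut f f' -> (f' x == x) = (f x == x).
Proof.
move=> [_ fK f'K]; apply/eqP/eqP => fx; last by rewrite -{1}fx fK.
by rewrite -{1}fx f'K.
Qed.

(** By [orbit_exceeds] the orbit of [x] passes [y]. If this first happens at index [m.+1], the
    [m]-th iterate is at most [y], and its image, which exceeds [y], is at most [f y]. *)
Lemma lt_fix_free f f' x y : order_aut f f' -> x <= y ->
  (forall z, x <= z <= y -> f z != z) -> x < f x -> y < f y.
Proof.
move=> fP xy nofix xf.
have [|n yn] := @orbit_exceeds f f' x y fP xf.
  by move=> z /andP[/ltW xz zy]; apply: nofix; rewrite xz.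
have ex : exists n, y < iter n f x by exists n.
case: (ex_minnP ex) => -[|m]; first by rewrite /= ltNge xy.
move=> ym min; apply: (lt_le_trans ym); rewrite iterS (order_aut_le fP).
by rewrite leNgt; apply/negP => /min; rewrite ltnn.
Qed.

(** The sign at the midpoint spreads to the right by [lt_fix_free]. A point on its left with the
    opposite sign would, by the same lemma for the inverse, force that sign at the midpoint. *)
Lemma up_or_up f f' x y : order_aut f f' -> x < y ->
  (forall z, x < z < y -> f z != z) -> up f x y \/ up f' x y.
Proof.
move=> fP xy nofix; pose m := (x + y) / 2.
have xm : x < m by rewrite /m; lra.
have my : m < y by rewrite /m; lra.
have key h h' : order_aut h h' -> (forall z, x < z < y -> h z != z) ->
    m < h m -> up h x y.
  move=> hP nh mh z /andP[xz zy].
  have [mz|zm] := leP m z.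
    apply: (lt_fix_free hP mz) => // w /andP[mw wz].
    by apply: nh; rewrite (lt_le_trans xm mw) (le_lt_trans wz zy).
  have := nh z; rewrite xz zy => /(_ erefl); rewrite neq_lt => /orP[|//].
  rewrite -(lt_invE _ hP) => zh'.
  have : m < h' m.
    apply: (lt_fix_free (order_autV hP) (ltW zm)) => // w /andP[zw wm].
    rewrite (fix_inv _ hP); apply: nh.
    by rewrite (lt_le_trans xz zw) (le_lt_trans wm my).
  by rewrite (lt_invE _ hP) ltNge (ltW mh).
have := nofix m; rewrite xm my => /(_ erefl); rewrite neq_lt => /orP[|mf].
  rewrite -(lt_invE _ fP) => fm; right; apply: key (order_autV fP) _ fm.
  by move=> z /nofix; rewrite (fix_inv _ fP).
by left; exact: key fP nofix mf.
Qed.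

(** Cells are half-open so that consecutive ones are disjoint and leave no gap; a cell is empty
    where [e] is stationary. *)
Definition cell e (i : int) x := e i <= x < e (i + 1).

Lemma int_homo_le e : (forall i, e i <= e (i + 1)) ->
  {homo e : i j / i <= j >-> i <= j}.
Proof.
move=> eS i j; rewrite -subr_ge0 => ij.
have -> : j = i + (`|j - i|%N)%:Z by rewrite gez0_abs; lia.
elim: `|_|%N => [|n IH]; first by rewrite addr0.
by apply: le_trans IH _; rewrite -addn1 PoszD addrA.
Qed.

Lemma cell_lt e i j x y : {homo e : i j / i <= j >-> i <= j} ->
  cell e i x -> cell e j y -> x <= y -> i <= j.
Proof.
move=> eh /andP[ix _] /andP[_ yj] xy; rewrite leNgt; apply/negP => ji.
have {}ji : j + 1 <= i by lia.
by have := lt_le_trans yj (le_trans (eh _ _ ji) (le_trans ix xy)); rewrite ltxx.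
Qed.

Lemma cell_uniq e i j x : {homo e : i j / i <= j >-> i <= j} ->
  cell e i x -> cell e j x -> i = j.
Proof.
by move=> eh ix jx; apply/eqP; rewrite eq_le (cell_lt eh ix jx)// (cell_lt eh jx ix).
Qed.

(** A point lies in at most one cell. For cells [i < j], monotonicity comes from
    [H i x < e' (i + 1) <= e' j <= H j y]. *)
Lemma glue e e' (H : int -> R -> R) :
  {homo e : i j / i <= j >-> i <= j} -> {homo e' : i j / i <= j >-> i <= j} ->
  (forall i x, cell e i x -> cell e' i (H i x)) ->
  (forall i x y, cell e i x -> cell e i y -> x < y -> H i x < H i y) ->
  exists2 h : R -> R, forall i x, cell e i x -> h x = H i x &
    forall i j x y, cell e i x -> cell e j y -> x < y -> h x < h y.
Proof.
move=> eh e'h Hcell Hlt.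
have /choice[idx idxP] x : exists i, forall j, cell e j x -> i = j.
  have [[i ix]|no] := pselect (exists i, cell e i x).
    by exists i => j; exact: cell_uniq.
  (* Points outside every cell receive the arbitrary index 0. *)
  by exists 0 => j jx; case: no; exists j.
exists (fun x => H (idx x) x) => [i x /idxP -> //|i j x y ix jy xy].
rewrite (idxP _ _ ix) (idxP _ _ jy).
have : i <= j by exact: cell_lt eh ix jy (ltW xy).
rewrite le_eqVlt => /predU1P[ij|ij].
  by rewrite -ij in jy *; exact: Hlt.
have /andP[_ hx] := Hcell _ _ ix; have /andP[hy _] := Hcell _ _ jy.
by apply: lt_le_trans hx (le_trans _ hy); apply: e'h; lia.
Qed.

(** [Negz n] is -(n + 1), whence the [n.+1] steps of [d]. The maps [u] and [d] may fail to be
    mutually inverse: [enumeration] takes a successor and a predecessor map. *)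
Definition ziter u d (i : int) x :=
  match i with Posz n => iter n u x | Negz n => iter n.+1 d x end.

Lemma ziter_Negz1 u d n x : ziter u d (Negz n + 1) x = iter n d x.
Proof.
case: n => [|n]; first by rewrite (_ : Negz 0 + 1 = 0).
by rewrite (_ : Negz n.+1 + 1 = Negz n)//; lia.
Qed.

Lemma ziter_Posz1 u d n x : ziter u d (Posz n + 1) x = iter n.+1 u x.
Proof. by rewrite -PoszD addn1. Qed.

Lemma ziter_cover u d x0 x :
  (exists n, x < iter n u x0) -> (exists n, iter n d x0 <= x) ->
  exists i, cell (ziter u d ^~ x0) i x.
Proof.
move=> exu exd; have [x0x|xx0] := leP x0 x.
  case: (ex_minnP exu) => -[|n]; first by rewrite /= ltNge x0x.
  move=> xn min; exists (Posz n); rewrite /cell ziter_Posz1 xn andbT/=.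
  by rewrite leNgt; apply/negP => /min; rewrite ltnn.
case: (ex_minnP exd) => -[|n]; first by rewrite /= leNgt xx0.
move=> xn min; exists (Negz n); rewrite /cell ziter_Negz1/= xn/=.
by rewrite ltNge; apply/negP => /min; rewrite ltnn.
Qed.

Lemma order_aut_ziter f f' i : order_aut f f' ->
  order_aut (ziter f f' i) (ziter f' f i).
Proof.
move=> fP; case: i => n; first exact: order_aut_iter.
by apply: order_autV; exact: order_aut_iter n.+1 fP.
Qed.

Lemma ziterS f f' i x : order_aut f f' ->
  ziter f f' (i + 1) x = f (ziter f f' i x).
Proof.
move=> [_ _ f'K]; case: i => n; first by rewrite ziter_Posz1.
by rewrite ziter_Negz1/= f'K.
Qed.

Lemma ziterSr f f' i x : order_aut f f' ->
  ziter f f' (i + 1) x = ziter f f' i (f x).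
Proof.
move=> [_ fK _]; case: i => n; first by rewrite ziter_Posz1 iterSr.
by rewrite ziter_Negz1 /ziter iterSr fK.
Qed.

Lemma orbit_cover f f' a b x0 : order_aut f f' -> up f a b -> a < x0 < b ->
  forall x, a < x < b -> exists i, cell (ziter f f' ^~ x0) i x.
Proof.
move=> fP fup x0ab x xab.
have exc y z : a < y < b -> a < z < b -> exists n, z < iter n f y.
  move=> yab /andP[az zb]; apply: (orbit_exceeds fP); first exact: fup.
  move=> w /andP[yw wz]; rewrite gt_eqF//; apply: fup.
  by case/andP: yab => ay _; rewrite (lt_trans ay yw) (le_lt_trans wz zb).
apply: ziter_cover; first exact: exc.
(* If the [n]-th iterate of [x] exceeds [x0], then the [n]-th backward iterate of [x0] is below
   [x]. *)
have [n] := exc _ _ xab x0ab; exists n.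
rewrite -(order_aut_le (order_aut_iter n fP)); case: (order_aut_iter n fP) => _ _ ->; exact: ltW.
Qed.

End order_automorphisms.

Section conjugation.
Variable R : realType.
Implicit Types (f g : R -> R) (e : int -> R) (x y z : R).

Lemma orbit_homo f f' a b x0 : order_aut f f' -> f a = a -> f b = b ->
  up f a b -> a < x0 < b -> {homo (ziter f f' ^~ x0) : i j / i <= j >-> i <= j}
    /\ forall i, a < ziter f f' i x0 < b.
Proof.
move=> fP fa fb fup x0ab.
have inab i : a < ziter f f' i x0 < b.
  have fix_ziter y : f y = y -> ziter f f' i y = y.
    have [_ fK f'K] := fP.
    move=> fy; have f'y : f' y = y by rewrite -{1}fy fK.
    case: i => n; rewrite /ziter; elim: n => [|n IH] //; rewrite iterS.
      by rewrite IH.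
    by rewrite IH.
  have iP := order_aut_ziter i fP.
  by rewrite -{1}(fix_ziter a)// -{1}(fix_ziter b)// !(order_aut_lt iP).
split=> //; apply: int_homo_le => i; rewrite ziterS//; apply: ltW; exact: fup.
Qed.

(* Transport one fundamental domain [x0, f x0) affinely onto [y0, g y0) and
   spread the map over the orbits. *)
Lemma conj_interval_up f f' g g' a b c d :
  order_aut f f' -> order_aut g g' -> a < b -> c < d ->
  f a = a -> f b = b -> g c = c -> g d = d -> up f a b -> up g c d ->
  exists H : R -> R, [/\ forall x, a <= x < b -> c <= H x < d,
    forall x y, a <= x < b -> a <= y < b -> x < y -> H x < H y,
    forall y, c <= y < d -> exists2 x, a <= x < b & H x = y &
    forall x, a <= x < b -> H (f x) = g (H x)].
Proof.
move=> fP gP ab cd fa fb gc gd fup gup.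
pose x0 := (a + b) / 2; pose y0 := (c + d) / 2.
have x0ab : a < x0 < b by rewrite /x0; lra.
have y0cd : c < y0 < d by rewrite /y0; lra.
have [eh ein] := orbit_homo fP fa fb fup x0ab.
have [e'h e'in] := orbit_homo gP gc gd gup y0cd.
set e := ziter f f' ^~ x0 in eh ein *; set e' := ziter g g' ^~ y0 in e'h e'in *.
have xf : 0 < f x0 - x0 by rewrite subr_gt0; exact: fup.
have yg : 0 < g y0 - y0 by rewrite subr_gt0; exact: gup.
pose A x := y0 + (x - x0) / (f x0 - x0) * (g y0 - y0).
pose A' y := x0 + (y - y0) / (g y0 - y0) * (f x0 - x0).
have AK : cancel A A' by move=> x; rewrite /A/A'; field; rewrite !gt_eqF.
have A'K : cancel A' A by move=> x; rewrite /A/A'; field; rewrite !gt_eqF.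
have A_lt : {homo A : x y / x < y}.
  by move=> x y xy; rewrite ltrD2l ltr_pM2r// ltr_pM2r ?invr_gt0// ltrD2r.
have A_mono : {mono A : x y / x <= y} by exact: le_mono.
have Ax0 : A x0 = y0 by rewrite /A subrr !mul0r addr0.
have Afx0 : A (f x0) = g y0 by rewrite /A divff ?gt_eqF// mul1r addrC subrK.
have e1 i : e (i + 1) = ziter f f' i (f x0) by rewrite /e ziterSr.
have e'1 i : e' (i + 1) = ziter g g' i (g y0) by rewrite /e' ziterSr.
(* Pull the [i]-th cell back to the fundamental domain by the [i]-th power of [f'], apply [A], and
   push forward by the [i]-th power of [g]. *)
pose H i x := ziter g g' i (A (ziter f' f i x)).
have fiP i := order_aut_ziter i fP.
have giP i := order_aut_ziter i gP.
have HE i x : cell e i x = cell e' i (H i x).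
  have [_ fK f'K] := fiP i.
  rewrite /cell e1 e'1 /H /e /e' (order_aut_le (giP i)) (order_aut_lt (giP i)).
  rewrite -Afx0 -Ax0 A_mono (leW_mono A_mono).
  by rewrite -[in RHS](order_aut_le (fiP i)) -[in RHS](order_aut_lt (fiP i)) f'K.
have H_lt i x y : x < y -> H i x < H i y.
  move=> xy; rewrite (order_aut_lt (giP i)); apply: A_lt.
  by rewrite (order_aut_lt (order_autV (fiP i))).
have [||h hE h_lt] := @glue _ e e' H eh e'h.
  by move=> i x; rewrite HE.
  by move=> i x y _ _; exact: H_lt.
have cov x : a < x < b -> exists i, cell e i x by exact: orbit_cover fP fup x0ab x.
have cov' x : c < x < d -> exists i, cell e' i x by exact: orbit_cover gP gup y0cd x.
have cellP i x : cell e i x -> a < x < b.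
  move=> /andP[ix xi]; have /andP[ai _] := ein i; have /andP[_ bi] := ein (i + 1).
  by rewrite (lt_le_trans ai ix) (lt_trans xi bi).
have cell'P i x : cell e' i x -> c < x < d.
  move=> /andP[ix xi]; have /andP[ai _] := e'in i; have /andP[_ bi] := e'in (i + 1).
  by rewrite (lt_le_trans ai ix) (lt_trans xi bi).
have hin x : a < x < b -> c < h x < d.
  by move=> /cov[i ix]; rewrite (hE _ _ ix); apply: (cell'P i); rewrite -HE.
(* The orbit of [x0] only covers the open interval, so the left endpoint is sent to [c]
   separately. *)
exists (fun x => if x <= a then c else h x).
split=> [x|x y|y|x] /andP[ax xb].
- case: ifPn => [_|]; first by rewrite lexx.
  by rewrite -ltNge => ax'; have := hin x; rewrite ax' xb => /(_ erefl) /andP[/ltW -> ->].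
- move=> /andP[ay yb] xy; case: ifPn => xa; case: ifPn => ya.
  + by have := le_lt_trans ax (lt_le_trans xy ya); rewrite ltxx.
  + rewrite -ltNge in ya.
    by have := hin y; rewrite ya yb => /(_ erefl) /andP[-> _].
  + by have := le_lt_trans ax (lt_le_trans xy ya); rewrite ltxx.
  + rewrite -ltNge in xa; rewrite -ltNge in ya.
    have [i ix] := cov x ltac:(by rewrite xa xb).
    have [j jy] := cov y ltac:(by rewrite ya yb).
    exact: h_lt ix jy xy.
- move: ax; rewrite le_eqVlt => /predU1P[<-|cy]; first by exists a; rewrite lexx.
  have [i iy] := cov' y ltac:(by rewrite cy xb).
  pose x := ziter f f' i (A' (ziter g' g i y)).
  have Hx : H i x = y.
    have [_ fK f'K] := fiP i; have [_ gK g'K] := giP i.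
    by rewrite /H /x fK A'K g'K.
  have ix : cell e i x by rewrite HE Hx.
  have /andP[ax xb'] := cellP _ _ ix.
  by exists x; rewrite ?(ltW ax) ?xb'// leNgt ax/= (hE _ _ ix).
- move: ax; rewrite le_eqVlt => /predU1P[<-|ax]; first by rewrite fa lexx gc.
  rewrite !ifN -?ltNge//; last by rewrite -fa (order_aut_lt fP).
  have [i ix] := cov x ltac:(by rewrite ax xb).
  (* [f] shifts the cells by one; in [H (i + 1) (f x)] the extra [f'] cancels [f] and the extra [g]
     comes out. *)
  have ifx : cell e (i + 1) (f x).
    by move: ix; rewrite /cell /e !(ziterS _ _ fP) (order_aut_le fP) (order_aut_lt fP).
  rewrite (hE _ _ ifx) (hE _ _ ix) /H ziterS//; congr (g (ziter _ _ _ (A _))).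
  have [_ fK f'K] := fiP i; have [_ f1K _] := fiP (i + 1).
  by rewrite -[in LHS](f'K x) -(ziterS _ _ fP) f1K.
Qed.

(** A conjugacy between the inverses is also one between the maps themselves, which settles the
    downward case. *)
Lemma conj_interval f f' g g' a b c d :
  order_aut f f' -> order_aut g g' -> a < b -> c < d ->
  f a = a -> f b = b -> g c = c -> g d = d ->
  (up f a b /\ up g c d) \/ (up f' a b /\ up g' c d) ->
  exists H : R -> R, [/\ forall x, a <= x < b -> c <= H x < d,
    forall x y, a <= x < b -> a <= y < b -> x < y -> H x < H y,
    forall y, c <= y < d -> exists2 x, a <= x < b & H x = y &
    forall x, a <= x < b -> H (f x) = g (H x)].
Proof.
move=> fP gP ab cd fa fb gc gd [[fup gup]|[fup gup]].
  exact: conj_interval_up fP gP ab cd fa fb gc gd fup gup.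
have inv h h' x : order_aut h h' -> h x = x -> h' x = x.
  by move=> [_ hK _] hx; rewrite -{1}hx hK.
have [] := conj_interval_up (order_autV fP) (order_autV gP) ab cd
  (inv _ _ _ fP fa) (inv _ _ _ fP fb) (inv _ _ _ gP gc) (inv _ _ _ gP gd) fup gup.
move=> H [H1 H2 H3 H4]; exists H; split=> // x /andP[ax xb].
have [_ fK _] := fP; have [_ _ g'K] := gP.
rewrite -{2}(fK x) H4 ?g'K//.
by rewrite -{1}fa -{1}fb (order_aut_le fP) (order_aut_lt fP) ax.
Qed.

(** The conjugacies of the nonempty cells are glued on (0, 1) and extended by the identity. Since
    the points [e i] are fixed, [f] preserves each cell, so the equation can be checked cell by
    cell. *)
Lemma conj_chain f f' g g' e e' :
  order_aut f f' -> order_aut g g' ->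
  {homo e : i j / i <= j >-> i <= j} -> {homo e' : i j / i <= j >-> i <= j} ->
  (forall i, f (e i) = e i) -> (forall i, g (e' i) = e' i) ->
  (forall i, 0 <= e i <= 1) -> (forall i, 0 <= e' i <= 1) ->
  (forall x, 0 < x < 1 -> exists i, cell e i x) ->
  (forall x, 0 < x < 1 -> exists i, cell e' i x) ->
  (forall x, ~ 0 < x < 1 -> f x = x) -> (forall x, ~ 0 < x < 1 -> g x = x) ->
  (forall i, (e i < e (i + 1)) = (e' i < e' (i + 1))) ->
  (forall i, e i < e (i + 1) ->
    (up f (e i) (e (i + 1)) /\ up g (e' i) (e' (i + 1))) \/
    (up f' (e i) (e (i + 1)) /\ up g' (e' i) (e' (i + 1)))) ->
  exists h : R -> R, [/\ {homo h : x y / x < y}, forall y, exists x, h x = y,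
    h 0 = 0, h 1 = 1 & forall x, h (f x) = g (h x)].
Proof.
move=> fP gP eh e'h fe ge e01 e'01 cov cov' fout gout ee' signs.
have /choice[H HP] i : exists H : R -> R, e i < e (i + 1) -> 
   [/\ forall x, cell e i x -> cell e' i (H x),
    forall x y, cell e i x -> cell e i y -> x < y -> H x < H y,
    forall y, cell e' i y -> exists2 x, cell e i x & H x = y &
    forall x, cell e i x -> H (f x) = g (H x)].
  have [ii|ii] := boolP (e i < e (i + 1)); last by exists id.
  have ii' := ii; rewrite ee' in ii'.
  have [H HP] := conj_interval fP gP ii ii' (fe _) (fe _) (ge _) (ge _) (signs _ ii).
  by exists H.
have cell_ne i x : cell e i x -> e i < e (i + 1).
  by move=> /andP[]; exact: le_lt_trans.
have cell'_ne i x : cell e' i x -> e i < e (i + 1).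
  by move=> /andP[ix xi]; rewrite ee' (le_lt_trans ix xi).
have [||h hE h_lt] := @glue _ e e' H eh e'h.
  by move=> i x ix; have [H1 _ _ _] := HP i (cell_ne _ _ ix); exact: H1.
  by move=> i x y ix; have [_ H2 _ _] := HP i (cell_ne _ _ ix); exact: H2.
have cellP i x : cell e i x -> 0 <= x < 1.
  move=> /andP[ix xi]; have /andP[ai _] := e01 i; have /andP[_ bi] := e01 (i + 1).
  by rewrite (le_trans ai ix) (lt_le_trans xi bi).
have hin i x : cell e i x -> cell e' i (h x).
  by move=> ix; rewrite (hE _ _ ix); have [H1 _ _ _] := HP i (cell_ne _ _ ix); exact: H1.
have hin01 x : 0 < x < 1 -> 0 < h x < 1.
  move=> /andP[x0 x1].
  have [i ix] := cov x ltac:(by rewrite x0 x1).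
  (* Comparison with [x / 2] makes positivity strict: [h x > h (x / 2) >= 0]. *)
  have [j jx] := cov (x / 2) ltac:(lra).
  have /andP[a1 a2] := hin _ _ ix; have /andP[a3 _] := hin _ _ jx.
  have /andP[a4 _] := e'01 j; have /andP[_ a5] := e'01 (i + 1).
  have := h_lt _ _ _ _ jx ix ltac:(lra).
  by move=> ?; apply/andP; split; lra.
exists (fun x => if 0 < x < 1 then h x else x); split.
- move=> x y xy; case: ifPn => xP; case: ifPn => yP //.
  + have [i ix] := cov _ xP; have [j jy] := cov _ yP.
    exact: h_lt ix jy xy.
  + have := hin01 _ xP; have {}yP : 1 <= y.
      by rewrite leNgt; apply: contra yP => y1; rewrite y1 andbT; case/andP: xP; lra.
    by case/andP; lra.
  + have := hin01 _ yP; have {}xP : x <= 0.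
      by rewrite leNgt; apply: contra xP => y1; rewrite y1; case/andP: yP; lra.
    by case/andP; lra.
- move=> y; have [y01|] := boolP (0 < y < 1); last by exists y; rewrite ifN.
  have surj z : 0 < z < 1 -> exists i x, [/\ cell e i x, 0 <= x < 1 & h x = z].
    move=> z01; have [j jz] := cov' _ z01.
    have [_ _ H3 _] := HP j (cell'_ne _ _ jz); have [x jx xz] := H3 _ jz.
    by exists j, x; split=> //; [exact: cellP jx|rewrite (hE _ _ jx)].
  have [i [x [ix /andP[x0 x1] xy]]] := surj _ y01.
  exists x; rewrite ifT// x1 andbT lt_neqAle x0 andbT; apply/eqP => x_eq0.
  (* A cell may have 0 as its left endpoint. If the preimage of [y] were 0, a preimage [x' >= 0] of
     the smaller value [y / 2] would contradict monotonicity. *)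
  have [j [x' [jx' /andP[x'0 _] x'y]]] := surj (y / 2) ltac:(lra).
  move: x'0; rewrite le_eqVlt => /predU1P[x'0|x'0].
    by move: y01; rewrite -xy; move: x'y; rewrite -x'0 x_eq0 xy; lra.
  by have := h_lt _ _ _ _ ix jx' ltac:(by rewrite -x_eq0); lra.
- by rewrite ltxx.
- by rewrite ltxx andbF.
- move=> x; have [x01|x01] := boolP (0 < x < 1); last first.
    by rewrite fout ?(negbTE x01) ?gout//; exact/negP.
  have f0 : f 0 = 0 by apply: fout; rewrite ltxx.
  have f1 : f 1 = 1 by apply: fout; rewrite ltxx andbF.
  rewrite -{1}f0 -{1}f1 !(order_aut_lt fP) x01.
  have [i ix] := cov _ x01.
  have ifx : cell e i (f x).
    by rewrite /cell -fe -[e (i + 1)]fe (order_aut_le fP) (order_aut_lt fP).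
  rewrite (hE _ _ ifx) (hE _ _ ix).
  by have [_ _ _ H4] := HP i (cell_ne _ _ ix); exact: H4.
Qed.

End conjugation.

(** * Enumeration of the fixed points *)

Section enumeration.
Variable R : realType.
Implicit Types (f g u d : R -> R) (e : int -> R) (x y z : R) (A B : set R).

Lemma seq_has_min (s : seq R) x : x \in s ->
  exists2 m, m \in s & forall y, y \in s -> m <= y.
Proof.
elim: s x => // a s IH x _.
have [->|[b bs]] : s = [::] \/ exists b, b \in s.
- by case: s {IH} => [|b s]; [left|right; exists b; rewrite mem_head].
- by exists a; rewrite ?mem_head// => y; rewrite mem_seq1 => /eqP ->.
have [m ms mP] := IH _ bs; have [am|ma] := leP a m.
  exists a; rewrite ?mem_head// => y; rewrite inE => /predU1P[->//|/mP].
  exact: le_trans.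
exists m; rewrite ?inE ?ms ?orbT// => y; rewrite inE => /predU1P[->|/mP//].
exact: ltW.
Qed.

Lemma next_point A x y : x < y -> A y ->
  finite_set [set w | x < w <= y /\ A w] ->
  exists z, [/\ x < z <= y, A z & forall w, x < w < z -> ~ A w].
Proof.
move=> xy Ay /finite_seqP[s sE].
have inE' w : (w \in s) <-> (x < w <= y /\ A w).
  by have := congr1 (@^~ w) sE => /= ->.
have [|m /inE'[/andP[xm my] Am] mP] := @seq_has_min s y.
  by apply/inE'; rewrite xy lexx.
exists m; split; rewrite ?xm// => w /andP[xw wm] Aw.
have /mP : w \in s by apply/inE'; rewrite xw (le_trans (ltW wm) my).
by rewrite leNgt wm.
Qed.

Lemma prev_point A x y : y < x -> A y ->
  finite_set [set w | y <= w < x /\ A w] ->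
  exists z, [/\ y <= z < x, A z & forall w, z < w < x -> ~ A w].
Proof.
move=> yx Ay fin.
have [|||z [/andP[z1 z2] z3 z4]] := @next_point [set w | A (- w)] (- x) (- y).
- by rewrite ltrN2.
- by rewrite /= opprK.
- apply: sub_finite_set (finite_image -%R fin) => w /= [/andP[xw wy] Aw].
  by exists (- w); rewrite ?opprK// lerNr wy ltrNl xw.
exists (- z); split=> //; first by rewrite lerNr z2 ltrNl z1.
move=> w /andP[zw wx] Aw; apply: (z4 (- w)); last by rewrite /= opprK.
by rewrite ltrN2 wx ltrNl zw.
Qed.

Lemma injective_seq_infinite B (u : nat -> R) : injective u ->
  (forall n, B (u n)) -> ~ finite_set B.
Proof.
move=> uI uB finB; apply: infinite_nat.
rewrite (_ : [set: nat] = u @^-1` B); last by apply/seteqP; split=> // n _; exact: uB.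
by apply: finite_preimage => // n m _ _; exact: uI.
Qed.

Lemma inc_seq_infinite B (u : nat -> R) : (forall n, u n < u n.+1) ->
  (forall n, B (u n)) -> ~ finite_set B.
Proof.
move=> uS; apply: injective_seq_infinite.
have u_lt : {homo u : n m / (n < m)%N >-> n < m}.
  by apply: homo_ltn => //; exact: lt_trans.
move=> n m unm; apply/eqP; rewrite eqn_leq leqNgt (leqNgt m).
by apply/andP; split; apply/negP => /u_lt; rewrite unm ltxx.
Qed.

Lemma dec_seq_infinite B (u : nat -> R) : (forall n, u n.+1 < u n) ->
  (forall n, B (u n)) -> ~ finite_set B.
Proof.
move=> uS uB finB.
apply: (@inc_seq_infinite [set - w | w in B] (fun n => - u n)).
- by move=> n; rewrite ltrN2.
- by move=> n; exists (u n).
- exact: finite_image.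
Qed.

(** Start at a point [p] of [A] in (0, 1), or at 0 if there is none, and iterate the successor and
    predecessor maps of [A], stationary at 1 and at 0. By local finiteness the iterates cannot stay
    on one side of an interior point. The last three conclusions make the nonempty cells a block of
    consecutive indices containing 0. *)
Lemma enumeration A : A 0 -> A 1 ->
  (forall a b, 0 < a -> b < 1 -> finite_set [set x | a <= x <= b /\ A x]) ->
  exists e, 
   [/\ {homo e : i j / i <= j >-> i <= j}, forall i, A (e i),
      forall i, 0 <= e i <= 1, forall x, 0 < x < 1 -> exists i, cell e i x &
      forall i z, e i < z < e (i + 1) -> ~ A z] /\
   [/\ e 0 < e 1,
     forall n : nat, e n.+1 < e (Posz n.+1 + 1) -> e n < e (Posz n + 1) &
     forall n, e (Negz n.+1) < e (Negz n.+1 + 1) -> e (Negz n) < e (Negz n + 1)].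
Proof.
move=> A0 A1 locfin.
have [p [Ap /andP[p0 p1] pP]] : exists p, [/\ A p, 0 <= p < 1 &
    0 < p \/ forall x, 0 < x < 1 -> ~ A x].
  have [[p [p01 Ap]]|no] := pselect (exists p, 0 < p < 1 /\ A p).
    by exists p; case/andP: p01 => p0 p1; rewrite (ltW p0) p1; split=> //; left.
  exists 0; rewrite lexx ltr01; split=> //; right=> x x01 Ax.
  by apply: no; exists x.
(* The successor in [A]; its value is irrelevant for [x < p] and for [x] outside [A]. *)
have /choice[nx nxP] x : exists z,
    (p <= x < 1 -> A x -> [/\ x < z <= 1, A z & forall w, x < w < z -> ~ A w])
    /\ (1 <= x -> z = x).
  have [x1|x1] := leP 1 x; first by exists x; split=> //; rewrite andbF.
  suff [[px Ax]|] : (p <= x /\ A x) \/ ~ (p <= x /\ A x).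
    suff [z zP] : exists z, [/\ x < z <= 1, A z & forall w, x < w < z -> ~ A w].
      by exists z; split.
    have [[y [/andP[xy y1] Ay]]|no] := pselect (exists y, x < y < 1 /\ A y).
      have x0 : 0 < x.
        case: pP => [p_gt0|noA]; first exact: lt_le_trans p_gt0 px.
        have := le_trans p0 px; rewrite le_eqVlt => /predU1P[x0|//].
        by case: (noA y) => //; rewrite x0 xy y1.
      have [|z [/andP[xz zy] Az zP]] := next_point xy Ay.
        apply: sub_finite_set (locfin _ _ x0 y1) => w /= [/andP[/ltW -> ->]].
        by [].
      by exists z; split=> //; rewrite xz (le_trans zy (ltW y1)).
    exists 1; split; rewrite ?x1 ?lexx// => w xw Aw; apply: no.
    by exists w.
  by move=> nA; exists x; split=> // /andP[px _] Ax; case: nA.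
  exact: EM.
have /choice[pv pvP] x : exists z,
    (0 < x <= p -> A x -> [/\ 0 <= z < x, A z & forall w, z < w < x -> ~ A w])
    /\ (x <= 0 -> z = x).
  have [x0|x0] := leP x 0; first by exists x.
  have [[xp Ax]|nA] := pselect (x <= p /\ A x); last first.
    by exists x; split=> // /andP[_ xp] Ax; case: nA.
  suff [z zP] : exists z, [/\ 0 <= z < x, A z & forall w, z < w < x -> ~ A w].
    by exists z; split.
  have [[y [/andP[y0 yx] Ay]]|no] := pselect (exists y, 0 < y < x /\ A y).
    have [|z [/andP[yz zx] Az zP]] := prev_point yx Ay.
      apply: sub_finite_set (locfin _ _ y0 (le_lt_trans xp p1)) => w /=.
      by move=> [/andP[-> /ltW ->]].
    by exists z; split=> //; rewrite zx (le_trans (ltW y0) yz).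
  exists 0; split; rewrite ?x0 ?lexx// => w wx Aw; apply: no.
  by exists w.
have nx1 n : [/\ A (iter n nx p), p <= iter n nx p & iter n nx p <= 1].
  elim: n => [|n [IH1 IH2]]; first by split=> //; exact: ltW.
  rewrite le_eqVlt => /predU1P[IH3|IH3].
    by rewrite iterS (nxP (iter n nx p)).2 ?IH3//; split=> //; exact: ltW.
  have [|//|/andP[nx1 nx2] nx3 _] := (nxP (iter n nx p)).1.
    by rewrite IH2 IH3.
  by split=> //; exact: le_trans IH2 (ltW nx1).
have pv1 n : [/\ A (iter n pv p), 0 <= iter n pv p & iter n pv p <= p].
  elim: n => [|n [IH1 + IH3]]; first by split.
  rewrite le_eqVlt => /predU1P[IH2|IH2].
    by rewrite iterS (pvP _).2 -IH2// (le_trans _ p0).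
  have [|//|/andP[pv1 pv2] pv3 _] := (pvP (iter n pv p)).1.
    by rewrite IH2 IH3.
  by split=> //; exact: le_trans (ltW pv2) IH3.
have nxlt n : iter n nx p < 1 -> iter n nx p < iter n.+1 nx p.
  move=> n1; have [B1 B2 _] := nx1 n.
  by have [||/andP[]] := (nxP (iter n nx p)).1; rewrite ?B2.
have pvlt n : 0 < iter n pv p -> iter n.+1 pv p < iter n pv p.
  move=> n0; have [B1 _ B3] := pv1 n.
  by have [||/andP[]] := (pvP (iter n pv p)).1; rewrite ?n0.
have nxle n : iter n nx p <= iter n.+1 nx p.
  have [/nxlt/ltW//|n1] := ltP (iter n nx p) 1.
  by rewrite iterS (nxP _).2.
have pvle n : iter n.+1 pv p <= iter n pv p.
  have [/pvlt/ltW//|n0] := ltP 0 (iter n pv p).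
  by rewrite iterS (pvP _).2.
exists (ziter nx pv ^~ p); split; split.
- apply: int_homo_le => -[n|n]; rewrite ?ziter_Posz1 ?ziter_Negz1/=; first exact: nxle.
  exact: pvle.
- by case=> n; [case: (nx1 n)|case: (pv1 n.+1)].
- case=> n; first by case: (nx1 n) => _ B1 ->; rewrite (le_trans p0 B1).
  by case: (pv1 n.+1) => _ -> B2; rewrite (le_trans B2 (ltW p1)).
- move=> x /andP[x0 x1]; apply: ziter_cover.
    apply/not_existsP => nox.
    have {}nox n : iter n nx p <= x by rewrite leNgt; apply/negP; exact: nox.
    (* Local finiteness requires a positive left end, and [p] may be 0, so the count starts at the
       first iterate. *)
    have p'0 : 0 < iter 1 nx p by apply: le_lt_trans p0 (nxlt 0%N p1).
    apply: inc_seq_infinite (locfin _ x p'0 x1) => [n|n].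
      by apply: (nxlt n.+1); exact: le_lt_trans (nox _) x1.
    split; last by case: (nx1 n.+1).
    rewrite nox andbT; elim: n => //n IH; exact: le_trans IH (nxle _).
  apply/not_existsP => nox.
  have {}nox n : x < iter n pv p by rewrite ltNge; apply/negP; exact: nox.
  apply: dec_seq_infinite (locfin _ p x0 p1) => [n|n].
    by apply: (pvlt n); exact: lt_trans (nox _).
  by case: (pv1 n) => B1 B2 B3; split=> //; rewrite (ltW (nox n)) B3.
- case=> n z; rewrite ?ziter_Posz1 ?ziter_Negz1.
    move=> /andP[nz zn]; have [B1 B2 B3] := nx1 n.
    have n1 : iter n nx p < 1.
      rewrite lt_neqAle B3 andbT; apply/eqP => n1; move: zn.
      by rewrite iterS (nxP _).2 n1 ?lexx// ltNge -n1 ltW.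
    by have [||_ _] := (nxP (iter n nx p)).1; rewrite ?B2//; apply; rewrite nz.
  move=> /andP[nz zn]; have [B1 B2 B3] := pv1 n.
  have n0 : 0 < iter n pv p.
    rewrite lt_neqAle B2 andbT eq_sym; apply/eqP => n0; move: nz.
    by rewrite /ziter iterS (pvP _).2 n0 ?lexx// ltNge -n0 ltW.
  by have [||_ _] := (pvP (iter n pv p)).1; rewrite ?n0//; apply; rewrite nz.
- by apply: (nxlt 0%N).
- move=> n; rewrite !ziter_Posz1 => nn; apply: (nxlt n).
  apply: le_lt_trans (nxle n) (lt_le_trans nn _).
  by case: (nx1 n.+2).
- move=> n; rewrite !ziter_Negz1 => nn; apply: (pvlt n).
  apply: lt_le_trans (pvle n); apply: le_lt_trans nn.
  by case: (pv1 n.+2).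
Qed.

End enumeration.

(** * Codes and conjugacy *)

Section codes.
Variable R : realType.
Implicit Types (f g : R -> R) (e : int -> R) (x y z : R).

(** In a code, [None] stands for infinitely many nonempty cells on one side, that is, for fixed
    points accumulating at that end of (0, 1). *)
Definition initial_segment (c : option nat) (n : nat) : bool :=
  if c is Some m then (n < m)%N else true.

Lemma initial_segmentP (Q : pred nat) : (forall n, Q n.+1 -> Q n) ->
  exists c, forall n, Q n = initial_segment c n.
Proof.
move=> Qdown; have [all_Q|/existsNP[k /negP nQk]] := pselect (forall n, Q n).
  by exists None => n; rewrite all_Q.
have ex : exists n, ~~ Q n by exists k.
case: (ex_minnP ex) => m nQm min; exists (Some m) => n /=.
apply/idP/idP => [Qn|]; last first.
  by rewrite ltnNge; apply: contraNT => /min.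
rewrite ltnNge; apply: contra nQm => mn.
have down j : Q (m + j)%N -> Q m.
  by elim: j => [|j IH]; rewrite ?addn0// addnS => /Qdown.
by apply: (down (n - m)%N); rewrite subnKC.
Qed.

Definition locally_finite_fix f :=
  forall a b, 0 < a -> b < 1 -> finite_set [set x | a <= x <= b /\ f x = x].

Definition signed f f' (b : bool) := if b then f else f'.

(* [f - id] changes sign at every isolated fixed point. *)
Definition crossing f f' := forall b x y z, 0 <= x -> x < y -> y < z -> z <= 1 ->
  f y = y -> ~ (up (signed f f' b) x y /\ up (signed f f' b) y z).

(* The cells of [e] are the components of the complement of the fixed points
   in (0, 1), together with empty cells once [e] has reached 0 or 1; the cell 0
   is nonempty.  A code records which cells are nonempty and the sign of
   [f - id] on the cell 0. *)
Definition coded f f' (c : option nat * option nat * bool) := exists e,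
  [/\ [/\ {homo e : i j / i <= j >-> i <= j}, forall i, f (e i) = e i,
      forall i, 0 <= e i <= 1 & forall x, 0 < x < 1 -> exists i, cell e i x],
   forall n : nat, (e n < e (Posz n + 1)) = initial_segment c.1.1 n,
   forall n, (e (Negz n) < e (Negz n + 1)) = initial_segment c.1.2 n &
   forall i, e i < e (i + 1) ->
    up (signed f f' (c.2 (+) odd `|i|%N)) (e i) (e (i + 1))].

(** Every nonempty cell has a sign by [up_or_up], and [crossing] forbids equal signs on adjacent
    nonempty cells. Signs therefore alternate, and the sign of the cell 0 and the parity of the
    index determine all of them. *)
Lemma coded_exists f f' : order_aut f f' -> f 0 = 0 -> f 1 = 1 ->
  locally_finite_fix f -> crossing f f' -> exists c, coded f f' c.
Proof.
move=> fP f0 f1 locfin cross.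
have [e [[eh fe e01 ecov egap] [e0 er el]]] := enumeration f0 f1 locfin.
have [cr crP] := initial_segmentP (Q := fun n : nat => e n < e (Posz n + 1)) er.
have [cl clP] := initial_segmentP (Q := fun n => e (Negz n) < e (Negz n + 1)) el.
have sgn i : e i < e (i + 1) -> exists b, up (signed f f' b) (e i) (e (i + 1)).
  move=> ii; have [|u|u] := up_or_up fP ii.
  - by move=> z zi; apply/eqP => /(egap _ _ zi).
  - by exists true.
  - by exists false.
have alt i b : e i < e (i + 1) -> e (i + 1) < e (i + 1 + 1) ->
    up (signed f f' b) (e i) (e (i + 1)) <->
    up (signed f f' (~~ b)) (e (i + 1)) (e (i + 1 + 1)).
  move=> i1 i2; have /andP[ei0 _] := e01 i; have /andP[_ ei1] := e01 (i + 1 + 1).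
  have no b' := @cross b' _ _ _ ei0 i1 i2 ei1 (fe _).
  have [b1 B1] := sgn _ i1; have [b2 B2] := sgn _ i2.
  split=> u.
  - have [<-//|b2b] := eqVneq b2 (~~ b).
    have b2E : b2 = b by move: b2b; case: (b2); case: (b).
    by case: (no b); split=> //; rewrite -b2E.
  - have [<-//|b1b] := eqVneq b1 b.
    have b1E : b1 = ~~ b by move: b1b; case: (b1); case: (b).
    by case: (no (~~ b)); split=> //; rewrite -b1E.
have [s sP] := sgn 0 e0.
exists (cr, cl, s), e; split=> //= -[n|n].
- rewrite absz_nat; elim: n => [|n IH] n1; first by rewrite addbF.
  have n0 : e n < e (Posz n + 1) by apply: er.
  have nS : Posz n + 1 = n.+1 by lia.
  rewrite -nS in n1 *; rewrite [odd _]/= addbN; exact/(alt _ _ n0 n1)/IH.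
- rewrite (_ : `|Negz n|%N = n.+1)//; elim: n => [|n IH] n1.
    rewrite /= addbT; have n1E : Negz 0 + 1 = 0 by [].
    by apply/alt; rewrite ?negbK ?n1E.
  have n0 : e (Negz n) < e (Negz n + 1) by apply: el.
  have nS : Negz n.+1 + 1 = Negz n by lia.
  have -> : s (+) odd n.+2 = ~~ (s (+) odd n.+1) by rewrite -addbN.
  by apply/(alt _ _ n1); rewrite ?negbK nS//; exact: IH.
Qed.

Lemma coded_conj f f' g g' c : order_aut f f' -> order_aut g g' ->
  (forall x, ~ 0 < x < 1 -> f x = x) -> (forall x, ~ 0 < x < 1 -> g x = x) ->
  coded f f' c -> coded g g' c ->
  exists h : R -> R, [/\ {homo h : x y / x < y}, forall y, exists x, h x = y,
    h 0 = 0, h 1 = 1 & forall x, h (f x) = g (h x)].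
Proof.
move=> fP gP fout gout.
move=> [e [[eh fe e01 ecov] er el es]] [e' [[e'h ge e'01 e'cov] e'r e'l e's]].
have ee' i : (e i < e (i + 1)) = (e' i < e' (i + 1)).
  by case: i => n; [rewrite er e'r|rewrite el e'l].
apply: (conj_chain fP gP eh e'h) => // i ii.
have := es i ii; have := e's i; rewrite -ee' => /(_ ii).
by case: (_ (+) _) => /= u v; [left|right].
Qed.

End codes.

(** * The action of the group on the line *)

Section real_action.
Variable R : realType.
Local Notation I := (unit_interval R).
Implicit Types (f g : homeo01 R) (x y : R).

Let toI (x : R) : I := insubd (point : I) x.

Let toIK (x : I) : toI (sval x) = x.
Proof. by apply: val_inj; rewrite val_insubd; case: x => x /= ->. Qed.

Let val_toI x : 0 <= x <= 1 -> sval (toI x) = x.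
Proof.
by move=> x01; rewrite val_insubd ifT//; apply/mem_set; rewrite /= in_itv.
Qed.

Let sval01 (x : I) : 0 <= sval x <= 1.
Proof. by case: x => x /= /set_mem; rewrite /= in_itv. Qed.

(** [toI] takes a default value outside [0, 1], hence the case distinction; the identity there makes
    [ext f] an order automorphism of the whole line. *)
Definition ext f x : R :=
  if 0 <= x <= 1 then sval (homeo01_fun f (toI x)) else x.

Let ext_in f x : 0 <= x <= 1 -> 0 <= ext f x <= 1.
Proof. by move=> x01; rewrite /ext x01. Qed.

Lemma extM f g x : ext (f * g)%g x = ext f (ext g x).
Proof.
rewrite {1 3}/ext; case: ifPn => [x01|x01]; last by rewrite /ext (negbTE x01).
by rewrite /ext sval01 toIK.
Qed.

Lemma ext1 x : ext 1%g x = x.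
Proof. by rewrite /ext; case: ifPn => // x01; rewrite /= val_toI. Qed.

Let ext_lt f : {homo ext f : x y / x < y}.
Proof.
have out z : ~~ (0 <= z <= 1) -> ext f z = z by rewrite /ext => /negbTE ->.
move=> x y xy; have [x01|x01] := boolP (0 <= x <= 1);
  have [y01|y01] := boolP (0 <= y <= 1).
- rewrite /ext x01 y01; have [_ _] := homeo01P f; apply.
  by rewrite /= !val_toI.
- have /andP[_ +] := ext_in f x01; rewrite (out y)//.
  by move: y01; rewrite negb_and -!ltNge; lra.
- have /andP[+ _] := ext_in f y01; rewrite (out x)//.
  by move: x01; rewrite negb_and -!ltNge; lra.
- by rewrite !out.
Qed.

Lemma ext_aut f : order_aut (ext f) (ext f^-1%g).
Proof.
split=> [x y|x|x]; first exact: ext_lt.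
- by rewrite -extM mulVg ext1.
- by rewrite -extM mulgV ext1.
Qed.

(** Both [f] and its inverse send 0 to a nonnegative point. *)
Lemma ext0 f : ext f 0 = 0.
Proof.
have in01 : 0 <= (0 : R) <= 1 by rewrite lexx ler01.
have /andP[f0 _] := ext_in f in01; have /andP[f'0 _] := ext_in f^-1%g in01.
apply/eqP; rewrite eq_le f0 andbT.
by rewrite -(order_aut_le (order_autV (ext_aut f))) -extM mulVg ext1.
Qed.

Lemma ext_1 f : ext f 1 = 1.
Proof.
have in01 : 0 <= (1 : R) <= 1 by rewrite lexx ler01.
have /andP[_ f0] := ext_in f in01; have /andP[_ f'0] := ext_in f^-1%g in01.
apply/eqP; rewrite eq_le f0/=.
by rewrite -(order_aut_le (order_autV (ext_aut f))) -extM mulVg ext1.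
Qed.

Lemma ext_out f x : ~ 0 < x < 1 -> ext f x = x.
Proof.
move=> x01; rewrite {1}/ext; case: ifPn => // /andP[x0 x1].
have [->|x_neq0] := eqVneq x 0; first by have := ext0 f; rewrite /ext lexx ler01.
have [->|x_neq1] := eqVneq x 1; first by have := ext_1 f; rewrite /ext lexx ler01.
by case: x01; rewrite !lt_neqAle x0 x1 x_neq1 eq_sym x_neq0.
Qed.

Lemma ext_inj f g : (forall x, 0 <= x <= 1 -> ext f x = ext g x) -> f = g.
Proof.
move=> fg; apply: homeo01_eq => x; apply: val_inj.
by have := fg (sval x) (sval01 x); rewrite /ext sval01 toIK.
Qed.

Lemma ball_unit_interval (x y : I) e : ball x e y = ball (sval x) e (sval y).
Proof. by []. Qed.

(** Preimages of [h x - e] and [h x + e] bound a neighbourhood of [x] that is mapped into the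
    [e]-ball. *)
Lemma increasing_surj_continuous (h : R -> R) : {homo h : x y / x < y} ->
  (forall y, exists x, h x = y) -> continuous h.
Proof.
move=> h_lt surj x; apply/cvgrPdist_lt => e e0.
have h_mono : {mono h : x y / x < y} by apply: leW_mono; exact: le_mono.
have [[a ha] [b hb]] := (surj (h x - e), surj (h x + e)).
have ax : a < x by rewrite -h_mono ha gtrBl.
have xb : x < b by rewrite -h_mono hb ltrDl.
near=> y.
have : y \in `]a, b[ by near: y; apply: near_in_itvoo; rewrite in_itv/= ax.
by rewrite in_itv/= -h_mono -(h_mono y) ha hb ltr_distlC => /andP[-> ->].
Unshelve. all: by end_near. Qed.

Lemma unit_interval_continuous (h : R -> R) :
  (forall x, 0 <= x <= 1 -> 0 <= h x <= 1) -> continuous h ->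
  continuous (fun x : I => toI (h (sval x))).
Proof.
move=> h01 ch x P /nbhs_ballP[e e0 eP].
have /cvgrPdist_lt/(_ e e0) := ch (sval x).
rewrite near_simpl => /nbhs_ballP[d d0 dP].
apply/nbhs_ballP; exists d => // y xy; apply: eP.
by rewrite ball_unit_interval !val_toI; [exact: dP|exact: h01..].
Qed.

(** Brings order-theoretic constructions, such as the conjugacies above, back into the group. *)
Lemma ext_surj (h : R -> R) : {homo h : x y / x < y} ->
  (forall y, exists x, h x = y) -> h 0 = 0 -> h 1 = 1 ->
  exists f, forall x, 0 <= x <= 1 -> ext f x = h x.
Proof.
move=> h_lt surj h0 h1; have [h' h'K] := choice surj.
have hP : order_aut h h'.
  split=> // x; have h_mono : {mono h : x y / x <= y} by exact: le_mono.
  exact: inc_inj h_mono _ _ (h'K _).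
have h'0 : h' 0 = 0 by case: hP => _ hK _; rewrite -{1}h0 hK.
have h'1 : h' 1 = 1 by case: hP => _ hK _; rewrite -{1}h1 hK.
have in01 k k' x : order_aut k k' -> k 0 = 0 -> k 1 = 1 ->
    0 <= x <= 1 -> 0 <= k x <= 1.
  by move=> kP k0 k1; rewrite -{2}k0 -{2}k1 !(order_aut_le kP).
have [_ hK _] := hP.
have fP : @increasing_homeo R (fun x : I => toI (h (sval x))).
  split.
  - apply: unit_interval_continuous; first by move=> x; exact: in01 hP h0 h1.
    exact: increasing_surj_continuous h_lt surj.
  - exists (fun x : I => toI (h' (sval x))).
      apply: unit_interval_continuous.
        by move=> x; exact: in01 (order_autV hP) h'0 h'1.
      apply: increasing_surj_continuous.
        by have [] := order_autV hP.
      by move=> y; exists (h y).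
    split=> x; rewrite val_toI ?hK ?h'K ?toIK//.
      exact: in01 hP h0 h1 (sval01 x).
    exact: in01 (order_autV hP) h'0 h'1 (sval01 x).
  - move=> x y xy; rewrite !val_toI; first exact: h_lt.
      exact: in01 hP h0 h1 (sval01 y).
    exact: in01 hP h0 h1 (sval01 x).
exists (Homeo01 fP) => x x01; rewrite /ext x01 /= val_toI// val_toI//.
exact: in01 hP h0 h1 x01.
Qed.

Lemma ext_continuous x : continuous (ext ^~ x).
Proof.
have [x01|x01] := boolP (0 <= x <= 1); last first.
  rewrite (_ : ext ^~ x = cst x); first exact: cst_continuous.
  by apply/funext => f; rewrite /ext (negbTE x01).
move=> f P /nbhs_ballP[e e0 eP]; apply/homeo01_nbhsP.
exists [set xy | ball xy.1 e xy.2]; first by rewrite -entourage_ballE; exists e.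
by move=> g /= /(_ (toI x)) fg; apply: eP; rewrite /ext x01.
Qed.

Lemma continuous_homeo01 (phi : R -> homeo01 R) :
  (forall s t x, 0 <= x <= 1 -> `|ext (phi s) x - ext (phi t) x| <= `|s - t|) ->
  continuous phi.
Proof.
move=> phiL t P /homeo01_nbhsP[E + EP].
rewrite -entourage_ballE => -[e e0 eE].
apply/nbhs_ballP; exists e => // s ts; apply: EP => x.
apply: eE => /=; rewrite ball_unit_interval; apply: le_lt_trans ts.
by have := phiL t s _ (sval01 x); rewrite /ext sval01 toIK.
Qed.

End real_action.

(** * The family of Moebius maps *)

Section liminf_null.
Variable R : realType.
Local Notation mu := (@lebesgue_measure R).
Local Open Scope ereal_scope.

Lemma limn_einf_le (u : (\bar R)^nat) V : (forall n, u n <= V) ->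
  limn_einf u <= V.
Proof.
move=> uV; rewrite limn_einf_lim; apply: lime_le; first exact: is_cvg_einfs.
apply: nearW => n; apply: le_trans (uV n); apply: ereal_inf_lbound.
by exists n => /=.
Qed.

Lemma limn_einf_ge0 (u : (\bar R)^nat) : (forall n, 0 <= u n) ->
  0 <= limn_einf u.
Proof.
move=> u0; rewrite limn_einf_lim; apply: lime_ge; first exact: is_cvg_einfs.
by apply: nearW => n; apply: le_ereal_inf_tmp => _ [m _ <-].
Qed.

Lemma measurable_fun_limn_einf d (T : measurableType d) (D : set T)
    (f : (T -> \bar R)^nat) : (forall n, measurable_fun D (f n)) ->
  measurable_fun D (fun x => limn_einf (f ^~ x)).
Proof.
move=> mf; apply: measurableT_comp => //.
by apply: measurable_fun_limn_esup => n; exact: measurableT_comp.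
Qed.

(** By Fatou's lemma the lower limit has integral at most [V], so it is finite almost everywhere. *)
Lemma limn_einf_pinfty_negligible (f : (R -> \bar R)^nat) (V : R) :
  (forall n, measurable_fun [set: R] (f n)) -> (forall n t, 0 <= f n t) ->
  (forall n, \int[mu]_t f n t <= V%:E) ->
  mu.-negligible [set t | limn_einf (f ^~ t) = +oo].
Proof.
move=> mf f0 fV.
have : mu.-integrable setT (fun t => limn_einf (f ^~ t)).
  apply/integrableP; split; first exact: measurable_fun_limn_einf.
  under eq_integral do rewrite gee0_abs ?limn_einf_ge0//.
  have := @fatou _ _ _ mu setT measurableT f mf (fun n x _ => f0 n x).
  move=> /le_lt_trans; apply.
  exact: le_lt_trans (limn_einf_le fV) (ltry _).
move=> /integrable_ae[//|N [mN N0 sN]]; exists N; split=> // t /= tE.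
by apply: sN => /=; rewrite tE => /(_ I).
Qed.

End liminf_null.

(** * Moebius maps as multiplications in the odds coordinate *)

Section odds.
Variable R : realType.
Implicit Types s t x y : R.

Definition mobius t x := t * x / (1 + (t - 1) * x).

Definition odds x := x / (1 - x).

Lemma odds_lt x y : 0 < x -> y < 1 -> x < y -> odds x < odds y.
Proof.
move=> x0 y1 xy; rewrite /odds ltr_pdivrMr ?subr_gt0 ?(lt_trans xy)//.
by rewrite mulrAC ltr_pdivlMr ?subr_gt0//; nra.
Qed.

Lemma odds_gt0 x : 0 < x < 1 -> 0 < odds x.
Proof. by move=> /andP[x0 x1]; rewrite divr_gt0// subr_gt0. Qed.

Lemma odds_mono x y : 0 < x < 1 -> 0 < y < 1 -> (odds x <= odds y) = (x <= y).
Proof.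
move=> /andP[x0 x1] /andP[y0 y1]; have [|yx] := leP x y.
  rewrite le_eqVlt => /predU1P[->|xy]; first by rewrite lexx.
  by rewrite ltW// odds_lt.
by apply/negbTE; rewrite -ltNge odds_lt.
Qed.

Lemma mobius_denom_gt0 t x : 1 <= t -> 0 <= x -> 0 < 1 + (t - 1) * x.
Proof. nra. Qed.

Lemma odds_mobius t x : 1 <= t -> 0 < x < 1 -> odds (mobius t x) = t * odds x.
Proof.
move=> t1 /andP[x0 x1]; have := mobius_denom_gt0 t1 (ltW x0).
rewrite /odds /mobius => d0; field.
by rewrite !gt_eqF//; nra.
Qed.

Lemma mobius_lt t x y : 1 <= t -> 0 <= x -> x < y -> mobius t x < mobius t y.
Proof.
move=> t1 x0 xy; have y0 : 0 <= y by exact: le_trans x0 (ltW xy).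
rewrite /mobius ltr_pdivrMr ?mobius_denom_gt0// mulrAC.
rewrite ltr_pdivlMr ?mobius_denom_gt0//; nra.
Qed.

Lemma mobius_lt_param s t x : 1 <= s -> s < t -> 0 < x < 1 ->
  mobius s x < mobius t x.
Proof.
move=> s1 st /andP[x0 x1]; have t1 := le_trans s1 (ltW st).
have ds := mobius_denom_gt0 s1 (ltW x0); have dt := mobius_denom_gt0 t1 (ltW x0).
rewrite /mobius ltr_pdivrMr// mulrAC ltr_pdivlMr//.
have : 0 < (t - s) * (x * (1 - x)) by rewrite !mulr_gt0 ?subr_gt0.
nra.
Qed.

Lemma mobius_surj t y : 1 <= t -> 0 <= y <= 1 ->
  exists2 x, 0 <= x <= 1 & mobius t x = y.
Proof.
move=> t1 /andP[y0 y1]; have d0 : 0 < t - (t - 1) * y by nra.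
(* This is the Moebius map of parameter [1 / t] at [y]. *)
exists (y / (t - (t - 1) * y)).
  by rewrite divr_ge0 ?(ltW d0)//= ler_pdivrMr// mul1r; nra.
rewrite /mobius; field.
by rewrite !gt_eqF//; nra.
Qed.

(** The difference is [s - t] times [x (1 - x)] over the product of the two denominators; that
    factor is at most 1. *)
Lemma mobius_lipschitz s t x : 1 <= s -> 1 <= t -> 0 <= x <= 1 ->
  `|mobius s x - mobius t x| <= `|s - t|.
Proof.
move=> s1 t1 /andP[x0 x1].
have ds := mobius_denom_gt0 s1 x0; have dt := mobius_denom_gt0 t1 x0.
have -> : mobius s x - mobius t x =
    (s - t) * (x * (1 - x) / ((1 + (s - 1) * x) * (1 + (t - 1) * x))).
  by rewrite /mobius; field; rewrite !gt_eqF.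
rewrite normrM ler_piMr// ger0_norm; last first.
  by rewrite divr_ge0 ?mulr_ge0 ?subr_ge0// ltW.
rewrite ler_pdivrMr ?mulr_gt0// mul1r.
have : 1 <= (1 + (s - 1) * x) * (1 + (t - 1) * x).
  by rewrite -[leLHS]mulr1 ler_pM// lerDl mulr_ge0// subr_ge0.
apply: le_trans; nra.
Qed.

Lemma mobius_homeo t : 1 <= t ->
  exists f : homeo01 R, forall x, 0 <= x <= 1 -> ext f x = mobius t x.
Proof.
move=> t1; pose h x := if 0 <= x <= 1 then mobius t x else x.
have m0 : mobius t 0 = 0 by rewrite /mobius mulr0 mul0r.
have m1 : mobius t 1 = 1 by rewrite /mobius !mulr1 addrC subrK divff// gt_eqF// (lt_le_trans ltr01).
have h_in x : 0 <= x <= 1 -> 0 <= h x <= 1.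
  move=> x01; rewrite /h x01; case/andP: x01 => x0 x1.
  apply/andP; split.
    apply: divr_ge0; last exact/ltW/mobius_denom_gt0.
    by apply: mulr_ge0 => //; exact: le_trans ler01 t1.
  by rewrite ler_pdivrMr ?mobius_denom_gt0//; nra.
have [||||f fP] := @ext_surj R h; last by exists f => x x01; rewrite fP// /h x01.
- move=> x y xy; have := h_in x; have := h_in y; rewrite /h.
  case: ifPn => y01; case: ifPn => x01.
  + by move=> _ _; case/andP: x01 => x0 _; exact: mobius_lt.
  + move=> /(_ erefl) hy _; move: x01; rewrite negb_and -!ltNge.
    by case/andP: y01; lra.
  + move=> _ /(_ erefl) hx; move: y01; rewrite negb_and -!ltNge.
    by case/andP: x01; lra.
  + by [].
- move=> y; have [y01|y01] := boolP (0 <= y <= 1).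
    by have [x x01 xy] := mobius_surj t1 y01; exists x; rewrite /h x01.
  by exists y; rewrite /h (negbTE y01).
- by rewrite /h lexx ler01.
- by rewrite /h ler01 lexx.
Qed.

Lemma mobius_path : exists phi : R -> homeo01 R, continuous phi /\
  forall t x, 1 <= t -> 0 <= x <= 1 -> ext (phi t) x = mobius t x.
Proof.
(* Replacing [t] by [max 1 t], a 1-Lipschitz operation, defines the path on the whole line. *)
have max1 t : 1 <= Num.max 1 t by rewrite le_max lexx.
have [phi phiP] := choice (fun t => mobius_homeo (max1 t)).
exists phi; split=> [|t x t1 x01]; last by rewrite phiP// max_r.
apply: continuous_homeo01 => s t x x01; rewrite !phiP//.
apply: le_trans (mobius_lipschitz (max1 s) (max1 t) x01) _.
rewrite /Num.max; case: ltP => s1; case: ltP => t1; rewrite ?subrr ?normr0//.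
  by rewrite !ger0_norm; lra.
by rewrite !ler0_norm; lra.
Qed.

End odds.

(** * A criterion for Haar nullness *)

Section path_null.
Variable R : realType.
Local Notation mu := (@lebesgue_measure R).
Implicit Types (f g h : homeo01 R) (B : set (homeo01 R)).

Lemma closed_borel_measurable (G : topologicalGroupType) (C : set G) :
  closed C -> measurable (C : set (borel G)).
Proof.
move=> cC; rewrite -[C]setCK; apply: measurableC.
by apply: sub_sigma_algebra; exact: closed_openC.
Qed.

Lemma continuous_borel_measurable (G : topologicalGroupType) (psi : R -> G) :
  continuous psi ->
  measurable_fun [set: measurableTypeR R] (psi : measurableTypeR R -> borel G).
Proof.
move=> cpsi; apply: (@measurability _ _ (measurableTypeR R) (borel G) setT psi
  (@open G)) => //.
move=> _ [U oU <-]; rewrite setTI; apply: open_measurable.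
by apply: open_comp => // x _; exact: cpsi.
Qed.

Lemma continuous_mulg (T : topologicalType) (G : topologicalGroupType)
  (u v : T -> G) : continuous u -> continuous v ->
  continuous (fun t => u t * v t)%g.
Proof.
move=> cu cv t; apply: (@continuous_comp _ _ _ (fun t => (u t, v t))
  (fun x : G * G => x.1 * x.2)%g t); last exact: mulg_continuous.
by apply: cvg_pair; [exact: cu|exact: cv].
Qed.

Lemma continuous_mulg_lr (T : topologicalType) (G : topologicalGroupType)
  (psi : T -> G) (g h : G) : continuous psi ->
  continuous (fun t => g * psi t * h)%g.
Proof.
by move=> cpsi; do ?[apply: continuous_mulg => //]; exact: cst_continuous.
Qed.

(** Negligibility passes to subsets and countable unions without measurability conditions, which are
    dealt with only once, in [path_null_haar_null]. *)
Definition path_null (phi : R -> homeo01 R) B := forall g h,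
  mu.-negligible [set t | 1 <= t <= 2 /\ B (g * phi t * h)%g].

Lemma uniform_prob_negligible (a b : R) (ab : a < b) (N : set R) :
  measurable N -> mu.-negligible (N `&` `[a, b]) -> uniform_prob ab N = 0%E.
Proof.
move=> mN nN; have mNab : measurable (N `&` `[a, b]) by exact: measurableI.
have : uniform_prob ab N = uniform_prob ab (N `&` `[a, b]).
  by rewrite /uniform_prob integral_uniform_pdf.
move=> ->; have /null_content_dominatesP := dominates_uniform_prob ab; apply=> //.
exact: measure_negligible.
Qed.

Lemma path_null_haar_null phi B : continuous phi ->
  measurable (B : set (borel (homeo01 R))) -> path_null phi B ->
  borel_haar_null R B.
Proof.
move=> cphi mB nB; split=> //.
have lt12 : (1 : R) < 2 by rewrite ltr1n.
have mphi := continuous_borel_measurable cphi.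
pose X : {mfun measurableTypeR R >-> borel (homeo01 R)} := mfun_Sub (mem_set mphi).
exists (distribution (uniform_prob lt12) X) => g h.
(* A point [x] lies in [g B h] iff [g^-1 x h^-1] lies in [B], so nullity is used for the inverses of
   [g] and [h]. *)
transitivity (uniform_prob lt12 [set t | B (g^-1 * phi t * h^-1)%g]).
  congr (uniform_prob lt12 _); apply/seteqP; split=> t /=.
    by move=> [x Bx <-]; rewrite !mulgA mulVg mul1g mulgK.
  by move=> Bt; exists (g^-1 * phi t * h^-1)%g => //; rewrite !mulgA mulgV mul1g mulgVK.
apply: uniform_prob_negligible.
  have mpsi := continuous_borel_measurable 
    (continuous_mulg_lr (g := g^-1%g) (h := h^-1%g) cphi).
  by rewrite -[X in measurable X]setTI; exact: mpsi.
by apply: negligibleS (nB g^-1%g h^-1%g) => t /= [Bt]; rewrite in_itv.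
Qed.

End path_null.

(** * Tangential fixed points *)

Section touching.
Variable R : realType.
Local Notation mu := (@lebesgue_measure R).
Implicit Types (f g h : homeo01 R) (p q x y : R).

Lemma iter_ext n f x : iter n (ext f) x = ext (f ^+ n)%g x.
Proof. by elim: n => [|n IH]; rewrite ?ext1// iterS IH expgS extM. Qed.

Lemma continuous_expg (G : topologicalGroupType) n :
  continuous (fun u : G => u ^+ n)%g.
Proof.
elim: n => [|n IH]; first exact: cst_continuous.
rewrite (_ : (fun u : G => _) = (fun u => u * u ^+ n)%g); last first.
  by apply/funext => u; rewrite expgS.
by apply: continuous_mulg => // u; exact: cvg_id.
Qed.

(* The second condition says that [f] has a fixed point in [[p, q]], in a form
   which is visibly closed. *)
Definition touch p q : set (homeo01 R) :=
  [set f | (forall x, p <= x <= q -> x <= ext f x) /\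
           forall n, iter n (ext f) p <= q].

Lemma closed_touch p q : closed (touch p q).
Proof.
have -> : touch p q =
    (\bigcap_(x in [set x | p <= x <= q]) (fun f => ext f x) @^-1` [set y | x <= y]) `&`
    \bigcap_n ((fun f => ext (f ^+ n)%g p) @^-1` [set y | y <= q]).
  apply/seteqP; split=> f [f1 f2]; split=> //.
  - by move=> n _; rewrite /= -iter_ext.
  - by move=> n; rewrite iter_ext; exact: f2.
apply: closedI; apply: closed_bigI.
  move=> x _.
  apply: closed_comp => [f _|]; first exact: ext_continuous.
  exact: closed_ge.
move=> n _; apply: closed_comp => [f _|]; last exact: closed_le.
apply: (@continuous_comp _ _ _ (fun f => f ^+ n)%g (fun f => ext f p)).
  exact: continuous_expg.
exact: ext_continuous.
Qed.

(** A fixed point in the interval bounds the orbit of [p]; without one, the orbit passes [q] by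
    [orbit_exceeds]. *)
Lemma touchP p q f : p <= q ->
  touch p q f <-> (forall x, p <= x <= q -> x <= ext f x) /\
                  exists2 x, p <= x <= q & ext f x = x.
Proof.
move=> pq; split=> -[f1 f2]; split=> //; last first.
  move=> n; case: f2 => x /andP[px xq] fx; apply: le_trans xq.
  rewrite iter_ext -[leRHS](_ : ext (f ^+ n)%g x = x).
    by rewrite (order_aut_le (ext_aut _)).
  by rewrite -iter_ext; elim: n => //= n ->.
apply: contrapT => nofix.
have {}nofix x : p <= x <= q -> ext f x != x.
  by move=> xpq; apply/eqP => fx; apply: nofix; exists x.
have [|x /andP[/ltW px xq]|n] := orbit_exceeds (y := q) (x := p) (ext_aut f).
- by rewrite lt_neqAle eq_sym nofix ?f1 ?lexx.
- by apply: nofix; rewrite px.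
- by rewrite ltNge f2.
Qed.

Lemma negligible_subsingleton (A : set R) :
  (forall s t, A s -> A t -> s < t -> False) -> mu.-negligible A.
Proof.
move=> A1; have [[t At]|A0] := pselect (A !=set0).
  apply: negligibleS (_ : mu.-negligible [set t]).
    move=> s As /=; apply/eqP; rewrite eq_le !leNgt.
    by apply/andP; split; apply/negP; exact: A1.
  by apply/negligibleP => //; exact: lebesgue_measure_set1.
rewrite (_ : A = set0); first exact: negligible_set0.
by apply/seteqP; split=> // t At; apply: A0; exists t.
Qed.

Variable phi : R -> homeo01 R.
Hypothesis phiE : forall t x, 1 <= t -> 0 <= x <= 1 -> ext (phi t) x = mobius t x.

Lemma ext_in01 f x : 0 < x < 1 -> 0 < ext f x < 1.
Proof. by rewrite -{2}(ext0 f) -{2}(ext_1 f) !(order_aut_lt (ext_aut f)). Qed.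

Lemma mobius_path_lt g h s t x : 1 <= s -> s < t -> 0 < x < 1 ->
  ext (g * phi s * h)%g x < ext (g * phi t * h)%g x.
Proof.
move=> s1 st /(ext_in01 h) h01; rewrite !extM (order_aut_lt (ext_aut g)).
have /andP[/ltW h0 /ltW h1] := h01; have t1 := le_trans s1 (ltW st).
by rewrite !phiE ?h0//; exact: mobius_lt_param.
Qed.

(** The translates increase strictly with the parameter. If the map at [t] fixes [x], then for
    [s < t] the map at [s] is below the identity at [x]; so at most one parameter is possible. *)
Lemma touch_null p q : 0 < p -> p <= q -> q < 1 -> path_null phi (touch p q).
Proof.
move=> p0 pq q1 g h; apply: negligible_subsingleton => s t.
move=> [/andP[s1 _] /(touchP _ pq)[fs _]] [_ /(touchP _ pq)[_ [x xpq fx]]] st.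
have x01 : 0 < x < 1 by case/andP: xpq; lra.
have := mobius_path_lt g h s1 st x01.
by rewrite fx ltNge fs.
Qed.

Lemma touch_inv_null p q : 0 < p -> p <= q -> q < 1 ->
  path_null phi [set f | touch p q f^-1%g].
Proof.
move=> p0 pq q1 g h; apply: negligible_subsingleton => s t.
move=> [/andP[s1 _] /(touchP _ pq)[_ [x xpq fx]]] [_ /(touchP _ pq)[ft _]] st.
have x01 : 0 < x < 1 by case/andP: xpq; lra.
have := mobius_path_lt g h s1 st x01.
have /eqP -> : ext (g * phi s * h)%g x == x.
  by rewrite -(fix_inv _ (ext_aut _)) fx.
rewrite ltNge; apply/negP; rewrite negbK.
by rewrite -(order_aut_le (order_autV (ext_aut (g * phi t * h)%g))) -extM mulVg ext1 ft.
Qed.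

End touching.

(** * Accumulation of fixed points *)

Section accumulation.
Variable R : realType.
Local Notation mu := (@lebesgue_measure R).
Implicit Types (f g h : homeo01 R) (a b x y : R).

Definition grid a b (n i : nat) : R := a + i%:R * ((b - a) / n%:R).

(* By monotonicity, [f] belongs to [hit c d] as soon as it has a fixed point in
   [[c, d]]. *)
Definition hit (c d : R) : set (homeo01 R) :=
  [set f | ext f c <= d /\ c <= ext f d].

Definition hits a b n f : \bar R :=
  (\sum_(i < n) (\1_(hit (grid a b n i) (grid a b n i.+1)) f)%:E)%E.

(** A Borel set containing all maps with infinitely many fixed points in [[a, b)], by
    [infinite_fix_accumulating]. *)
Definition accumulating a b : set (homeo01 R) :=
  [set f | limn_einf (fun n => hits a b n f) = +oo%E].

Lemma closed_hit c d : closed (hit c d).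
Proof.
have -> : hit c d = ((fun f => ext f c) @^-1` [set y | y <= d]) `&`
    ((fun f => ext f d) @^-1` [set y | c <= y]) by [].
apply: closedI; apply: closed_comp => [f _|].
- exact: ext_continuous.
- exact: closed_le.
- exact: ext_continuous.
- exact: closed_ge.
Qed.

Lemma measurable_accumulating a b :
  measurable (accumulating a b : set (borel (homeo01 R))).
Proof.
have mh n : measurable_fun [set: borel (homeo01 R)] (hits a b n).
  apply: emeasurable_sum => i; apply/measurable_EFinP; apply: measurable_indic.
  exact: (@closed_borel_measurable (homeo01 R) _ (@closed_hit _ _)).
have mL : measurable_fun [set: borel (homeo01 R)]
    (fun f => limn_einf (fun n => hits a b n f)).
  exact: measurable_fun_limn_einf.
have := mL measurableT [set +oo%E] (@emeasurable_set1 R +oo%E).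
by rewrite setTI.
Qed.

Lemma grid_le a b n i j : a <= b -> (i <= j)%N -> grid a b n i <= grid a b n j.
Proof.
by move=> ab ij; rewrite lerD2l ler_wpM2r ?ler_nat// divr_ge0// subr_ge0.
Qed.

Lemma grid_end a b n : (0 < n)%N -> grid a b n n = b.
Proof.
by move=> n0; rewrite /grid mulrCA divff ?pnatr_eq0 -?lt0n// mulr1 addrC subrK.
Qed.

Lemma grid0 a b n : grid a b n 0 = a.
Proof. by rewrite /grid mul0r addr0. Qed.

(** A variation estimate for [K / G]: each term is [(K i.+1 - K i) / G i + K i * (1 / G i - 1 / G
    i.+1)]. Bounding [1 / G i] by [1 / G 0] and the factor [K i] by [K n] leaves two telescoping
    sums, each at most [K n / G 0]. *)
Lemma telescoping_bound (K G : nat -> R) n : (forall i, (i <= n)%N -> 0 < G i) ->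
  (forall i, (i <= n)%N -> 0 < K i) ->
  (forall i j, (i <= j <= n)%N -> K i <= K j) ->
  (forall i j, (i <= j <= n)%N -> G i <= G j) ->
  \sum_(i < n) (K i.+1 / G i - K i / G i.+1) <= 2 * K n / G 0%N.
Proof.
move=> G0 K0 Kle Gle.
apply: (@le_trans _ _ (\sum_(0 <= i < n)
    ((K i.+1 - K i) / G 0%N + K n * ((- (G i.+1)^-1) - (- (G i)^-1))))).
  rewrite -(big_mkord xpredT (fun i => K i.+1 / G i - K i / G i.+1)).
  apply: ler_sum_nat => i /andP[_ ilt]; have ile := ltnW ilt.
  have -> : K i.+1 / G i - K i / G i.+1 =
      (K i.+1 - K i) / G i + K i * (- (G i.+1)^-1 - - (G i)^-1) by lra.
  apply: lerD.
    rewrite ler_wpM2l ?subr_ge0 ?Kle ?leqnSn// lef_pV2 ?posrE ?G0//.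
    by apply: Gle; rewrite leq0n.
  rewrite ler_wpM2r ?Kle ?ile ?leqnn// opprK addrC subr_ge0.
  by rewrite lef_pV2 ?posrE ?G0// Gle// leqnSn.
rewrite big_split/= -mulr_suml -mulr_sumr !telescope_sumr// opprK.
have := K0 0%N (leq0n n); have := K0 n (leqnn n).
have Gn : 0 < (G n)^-1 by rewrite invr_gt0 G0.
have Gz : 0 < (G 0%N)^-1 by rewrite invr_gt0 G0.
nra.
Qed.

Lemma hits_card a b n f :
  hits a b n f = 
  #|[pred i : 'I_n | `[< hit (grid a b n i) (grid a b n i.+1) f >]]|%:R%:E.
Proof.
rewrite /hits sumEFin -sum1_card natr_sum [in RHS]big_mkcond/=; congr _%:E.
apply: eq_bigr => i _; rewrite indicE inE.
by case: asboolP => fi; [rewrite mem_set|rewrite memNset].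
Qed.

Lemma grid_cell a b n x : (0 < n)%N -> a <= x < b ->
  exists i : 'I_n, grid a b n i <= x < grid a b n i.+1.
Proof.
move=> n0 /andP[ax xb]; have ab := le_lt_trans ax xb.
pose w := (b - a) / n%:R; have w0 : 0 < w by rewrite divr_gt0 ?subr_gt0 ?ltr0n.
have /truncn_itv : 0 <= (x - a) / w by rewrite divr_ge0 ?subr_ge0// ltW.
set k := Num.trunc _ => /andP[k1 k2].
have kn : (k < n)%N.
  rewrite -(ltr_nat R); apply: le_lt_trans k1 _.
  by rewrite ltr_pdivrMr// mulrC divfK ?ltrD2r// pnatr_eq0 -lt0n.
exists (Ordinal kn); rewrite /grid/= -/w.
by rewrite -lerBrDl -ler_pdivlMr// k1 -ltrBlDl -ltr_pdivrMr.
Qed.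

(** Take [M] fixed points. Once the mesh is smaller than all their mutual distances they lie in
    distinct grid cells, and each of these cells is hit. *)
Lemma infinite_fix_accumulating a b f : a < b ->
  infinite_set [set x | a <= x < b /\ ext f x = x] -> accumulating a b f.
Proof.
move=> ab /infinite_set_fsetP inf; apply: (cvg_limn_einf_sup _).1.
apply/cvgeyPge => A.
pose M := (Num.trunc A).+1; have AM : A <= M%:R by exact/ltW/truncnS_gt.
have [B sB sizeB] := inf M.
pose t (j : 'I_M) := nth 0 (finmap.enum_fset B) j.
have tB j : a <= t j < b /\ ext f (t j) = t j.
  by apply: sB => /=; apply: mem_nth; exact: leq_trans sizeB.
have t_inj i j : t i = t j -> i = j.
  move/eqP; rewrite nth_uniq ?finmap.fset_uniq ?(leq_trans _ sizeB)//.
  by move=> /eqP/val_inj.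
have small : \forall n \near \oo, forall p : 'I_M * 'I_M,
    p.1 != p.2 -> (b - a) / n%:R < `|t p.1 - t p.2|.
  apply: filter_forall => -[i j] /=; have [->|ij] := eqVneq i j.
    by apply: nearW.
  have d0 : 0 < `|t i - t j|.
    by rewrite normr_gt0 subr_eq0; apply: contra ij => /eqP /t_inj ->.
  near=> n => _; have n0 : 0 < n%:R :> R.
    by rewrite ltr0n; near: n; exact: nbhs_infty_gt.
  rewrite ltr_pdivrMr// mulrC -ltr_pdivrMr//; near: n; exact: nbhs_infty_gtr.
near=> n; have n0 : (0 < n)%N by near: n; exact: nbhs_infty_gt.
have smalln : forall p : 'I_M * 'I_M,
  p.1 != p.2 -> (b - a) / n%:R < `|t p.1 - t p.2| by near: n.
have [idx idxP] := choice (fun j => grid_cell n0 (tB j).1).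
have idx_inj : injective idx.
  move=> i j ij; apply/eqP/negPn/negP => ne.
  have := smalln (i, j) ne; rewrite /= ltNge => /negP; apply.
  have := idxP i; have := idxP j; rewrite ij /grid.
  set w := (b - a) / n%:R; rewrite -natr1 (mulrDl _ _ w) mul1r.
  set v := _ * w => /andP[? ?] /andP[? ?].
  by rewrite ler_norml; apply/andP; split; lra.
rewrite hits_card lee_fin; apply: le_trans AM _; rewrite ler_nat.
rewrite -[leqLHS]card_ord -(card_imset _ idx_inj); apply: subset_leq_card.
apply/fintype.subsetP => _ /imsetP[j _ ->]; rewrite inE.
have /andP[jx /ltW xj] := idxP j; have fj := (tB j).2; split.
  by apply: le_trans xj; rewrite -[leRHS]fj (order_aut_le (ext_aut f)).
by apply: le_trans jx _; rewrite -[leLHS]fj (order_aut_le (ext_aut f)).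
Unshelve. all: by end_near. Qed.

Variable phi : R -> homeo01 R.
Hypothesis phiE : forall t x, 1 <= t -> 0 <= x <= 1 -> ext (phi t) x = mobius t x.

Lemma mobius_path_le t x y : 1 <= t -> 0 < x < 1 -> 0 < y < 1 ->
  (ext (phi t) x <= y) = (t <= odds y / odds x).
Proof.
move=> t1 x01 y01; rewrite -odds_mono ?ext_in01// phiE//; last first.
  by case/andP: x01 => /ltW -> /ltW ->.
by rewrite odds_mobius// (ler_pdivlMr _ _ (odds_gt0 x01)).
Qed.

Lemma mobius_path_ge t x y : 1 <= t -> 0 < x < 1 -> 0 < y < 1 ->
  (y <= ext (phi t) x) = (odds y / odds x <= t).
Proof.
move=> t1 x01 y01; rewrite -odds_mono ?ext_in01// phiE//; last first.
  by case/andP: x01 => /ltW -> /ltW ->.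
by rewrite odds_mobius// (ler_pdivrMr _ _ (odds_gt0 x01)).
Qed.

(** In the odds coordinate both inequalities of [hit] become linear in [t], so the parameters at
    least 1 that hit a cell are cut out by one closed interval. *)
Lemma hit_path g h t c d : 1 <= t -> 0 < c < 1 -> 0 < d < 1 ->
  hit c d (g * phi t * h)%g <->
  t \in `[odds (ext g^-1%g c) / odds (ext h d), odds (ext g^-1%g d) / odds (ext h c)].
Proof.
move=> t1 c01 d01; rewrite in_itv/=.
rewrite -mobius_path_le ?ext_in01// -mobius_path_ge ?ext_in01//.
have gK x : ext g (ext g^-1%g x) = x by rewrite -extM mulgV ext1.
rewrite -(order_aut_le (ext_aut g) (ext g^-1%g c)).
rewrite -(order_aut_le (ext_aut g) _ (ext g^-1%g d)) !gK -!extM.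
by rewrite /hit/=; split=> [[-> ->]//|/andP[]].
Qed.

(** A discrete form of Banach's indicatrix argument: the integral over [t] of the number of cells
    hit is at most a sum of interval lengths, which [telescoping_bound] bounds independently of the
    grid. Then [limn_einf_pinfty_negligible] applies. *)
Lemma accumulating_null a b : 0 < a -> a < b -> b < 1 ->
  path_null phi (accumulating a b).
Proof.
move=> a0 ab b1 g h.
pose x n i := grid a b n i.
pose K n i := odds (ext g^-1%g (x n i)).
pose G n i := odds (ext h (x n i)).
pose N n t : \bar R := (\sum_(i < n) (\1_(`[(K n i / G n i.+1), (K n i.+1 / G n i)]) t)%:E)%E.
have xin n i : (i <= n)%N -> 0 < x n i < 1.
  move=> ilen; have [->|n0] := posnP n; last first.
    rewrite (lt_le_trans a0)/= ?(le_lt_trans _ b1)//.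
      by rewrite -(grid_end a b n0); apply: grid_le => //; exact: ltW.
    by rewrite -(grid0 a b n); apply: grid_le => //; exact: ltW.
  (* For [n = 0] the mesh is 0 by the convention on inverses, so the grid is constantly [a]. *)
  by rewrite /x /grid invr0 !mulr0 addr0; lra.
have x_le n i j : (i <= j)%N -> x n i <= x n j by move=> ij; apply: grid_le => //; exact: ltW.
have K0 n i : (i <= n)%N -> 0 < K n i by move=> ilen; rewrite odds_gt0// ext_in01// xin.
have G0 n i : (i <= n)%N -> 0 < G n i by move=> ilen; rewrite odds_gt0// ext_in01// xin.
have Kle n i j : (i <= j <= n)%N -> K n i <= K n j.
  move=> /andP[ij jn]; rewrite odds_mono ?ext_in01 ?xin ?(leq_trans ij)//.
  by rewrite (order_aut_le (ext_aut _)) x_le.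
have Gle n i j : (i <= j <= n)%N -> G n i <= G n j.
  move=> /andP[ij jn]; rewrite odds_mono ?ext_in01 ?xin ?(leq_trans ij)//.
  by rewrite (order_aut_le (ext_aut _)) x_le.
have mJ n (i : nat) : measurable (`[(K n i / G n i.+1), (K n i.+1 / G n i)] : set R).
  exact: measurable_itv.
have mN n : measurable_fun [set: R] (N n).
  by apply: emeasurable_sum => i; apply/measurable_EFinP; apply: measurable_indic.
have N0 n t : (0 <= N n t)%E by apply: sume_ge0 => i _; rewrite lee_fin.
pose V : R := 2 * odds (ext g^-1%g b) / odds (ext h a).
have NV n : (\int[mu]_t N n t <= V%:E)%E.
  have [->|n0] := posnP n.
    rewrite /N; under eq_integral do rewrite big_ord0.
    rewrite integral0 lee_fin; apply: divr_ge0; first apply: mulr_ge0 => //;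
      by apply/ltW/odds_gt0/ext_in01; lra.
  rewrite ge0_integral_sum//; last first.
    by move=> i; apply/measurable_EFinP; apply: measurable_indic.
  have -> : V = 2 * K n n / G n 0%N by rewrite /V /K /G /x grid_end// grid0.
  apply: (@le_trans _ _ (\sum_(i < n) (K n i.+1 / G n i - K n i / G n i.+1)%:E)%E).
    apply: lee_sum => i _; rewrite integral_indic// setIT/=.
    (* For a degenerate interval the measure is 0, and it remains to see that the difference of the
       endpoints is nonnegative. *)
    rewrite lebesgue_measure_itv/=; case: ifPn => // _.
    have ilt := ltn_ord i; have ile := ltnW ilt.
    rewrite lee_fin subr_ge0; apply: ler_pM.
    - exact/ltW/K0.
    - by rewrite invr_ge0 ltW// G0.
    - by rewrite Kle// leqnSn.
    - by rewrite lef_pV2 ?posrE ?G0// Gle// leqnSn.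
  rewrite sumEFin lee_fin; apply: telescoping_bound; [exact: G0|exact: K0|exact: Kle|exact: Gle].
apply: negligibleS (limn_einf_pinfty_negligible mN N0 NV) => t [/andP[t1 _]].
rewrite /accumulating /= => <-; congr limn_einf; apply/funext => n.
apply: eq_bigr => i _; congr (_%:E); rewrite !indicE; congr (nat_of_bool _)%:R.
have E := hit_path g h t1 (xin n i (ltnW (ltn_ord i))) (xin n i.+1 (ltn_ord i)).
by apply/idP/idP => /set_mem ti; apply/mem_set; exact/E.
Qed.

End accumulation.

(** * Generic homeomorphisms *)

Section generic_homeomorphisms.
Variable R : realType.
Implicit Types (f g h : homeo01 R) (p q x y : R).

Definition bad_on p q : set (homeo01 R) :=
  touch p q `|` [set f | touch p q f^-1%g] `|` accumulating p q.

(** Rational endpoints keep the union countable; the guard keeps the interval inside (0, 1), where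
    the nullity lemmas apply. *)
Definition bad_rat (r : rat * rat) : set (homeo01 R) :=
  let p : R := ratr r.1 in let q : R := ratr r.2 in
  if [&& 0 < p, p < q & q < 1] then bad_on p q else set0.

Definition bad : set (homeo01 R) := \bigcup_n oapp bad_rat set0 (unpickle n).

Lemma measurable_bad_on p q : measurable (bad_on p q : set (borel (homeo01 R))).
Proof.
apply: measurableU; last exact: measurable_accumulating.
apply: measurableU; apply: (@closed_borel_measurable (homeo01 R)).
  exact: closed_touch.
rewrite (_ : [set f | _] = (fun f => f^-1)%g @^-1` touch p q)//.
apply: closed_comp => [f _|]; last exact: closed_touch.
exact: invg_continuous.
Qed.

(** All pieces are null along the same Moebius path, so their countable union is too. *)
Lemma borel_haar_null_bad : borel_haar_null R bad.
Proof.
have [phi [cphi phiE]] := mobius_path R.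
apply: (path_null_haar_null cphi).
  apply: bigcup_measurable => n _.
  case: (unpickle n) => [r|]; last exact: measurable0.
  rewrite /= /bad_rat; case: ifPn => _; first exact: measurable_bad_on.
  exact: measurable0.
move=> g h.
have null0 : path_null phi set0.
  move=> g' h'; rewrite (_ : [set t | _] = set0); first exact: negligible_set0.
  by apply/seteqP; split=> t // [].
have nullU A B : path_null phi A -> path_null phi B -> path_null phi (A `|` B).
  move=> nA nB g' h'; apply: negligibleS (negligibleU (nA g' h') (nB g' h')).
  by move=> t [t12 [At|Bt]]; [left|right].
rewrite (_ : [set t | _] = \bigcup_n [set t | 1 <= t <= 2 /\
    oapp bad_rat set0 (unpickle n) (g * phi t * h)%g]); last first.
  apply/seteqP; split=> t /=; first by move=> [t12 [n _ nt]]; exists n.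
  by move=> [n _ [t12 nt]]; split=> //; exists n.
apply: negligible_bigcup => n; move: g h.
case: (unpickle n) => [r|]; last exact: null0.
rewrite /= /bad_rat; case: ifPn => [/and3P[p0 pq q1]|_]; last exact: null0.
refine (nullU _ _ (nullU _ _ _ _) _).
- exact (touch_null phiE p0 (ltW pq) q1).
- exact (touch_inv_null phiE p0 (ltW pq) q1).
- exact (accumulating_null phiE p0 pq q1).
Qed.

Lemma sub_bad r : bad_rat r `<=` bad.
Proof. by move=> f rf; exists (pickle r); [exact: I|rewrite pickleK]. Qed.

Lemma not_bad_on f (p q : rat) : ~ bad f -> 0 < ratr p :> R ->
  ratr p < ratr q :> R -> ratr q < 1 :> R -> ~ bad_on (ratr p) (ratr q) f.
Proof.
move=> nf p0 pq q1 fpq; apply: nf; apply: (@sub_bad (p, q)).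
by rewrite /bad_rat [(p, q).1]/= [(p, q).2]/= p0 pq q1.
Qed.

Lemma not_bad_locally_finite f : ~ bad f -> locally_finite_fix (ext f).
Proof.
move=> nf a b a0 b1; apply: contrapT => inf.
(* Taking [p] below 1/2 and [q] above it ensures [p < q] even when [b < a]. *)
have [|p] := @rat_in_itvoo R 0 (Num.min a (1 / 2)).
  by rewrite lt_min a0/=; lra.
rewrite in_itv/= lt_min => /and3P[p0 pa p2].
have [|q] := @rat_in_itvoo R (Num.max b (1 / 2)) 1.
  by rewrite gt_max b1/=; lra.
rewrite in_itv/= gt_max => /andP[/andP[bq q2] q1].
have pq : ratr p < ratr q :> R by exact: lt_trans p2 q2.
apply: (not_bad_on nf p0 pq q1); right; apply: infinite_fix_accumulating => //.
apply: sub_infinite_set inf => x /= [/andP[ax xb] fx]; split=> //.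
by rewrite (le_trans (ltW pa) ax) (le_lt_trans xb bq).
Qed.

(** A fixed point with the same sign on both sides is a touching point, for [f] or its inverse, on a
    rational interval around it. *)
Lemma not_bad_crossing f : ~ bad f -> crossing (ext f) (ext f^-1%g).
Proof.
move=> nf b x y z x0 xy yz z1 fy [u1 u2].
have [p] := rat_in_itvoo xy; rewrite in_itv/= => /andP[xp py].
have [q] := rat_in_itvoo yz; rewrite in_itv/= => /andP[yq qz].
have key g : up (ext g) x y -> up (ext g) y z -> ext g y = y ->
    touch (ratr p) (ratr q) g.
  move=> v1 v2 gy; apply/touchP; first exact: ltW (lt_trans py yq).
  split=> [w /andP[pw wq]|]; last by exists y => //; rewrite !ltW.
  have [wy|yw|->] := ltgtP w y; last by rewrite gy.
    by apply/ltW/v1; rewrite (lt_le_trans xp pw).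
  by apply/ltW/v2; rewrite yw (le_lt_trans wq qz).
apply: (not_bad_on nf (le_lt_trans x0 xp) (lt_trans py yq) (lt_le_trans qz z1)).
left; case: b u1 u2 => /= u1 u2; [left|right]; apply: key => //.
by apply/eqP; rewrite (fix_inv _ (ext_aut f)) fy.
Qed.

Lemma not_bad_coded f : ~ bad f -> exists c, coded (ext f) (ext f^-1%g) c.
Proof.
move=> nf; apply: coded_exists; first exact: ext_aut.
- exact: ext0.
- exact: ext_1.
- exact: not_bad_locally_finite.
- exact: not_bad_crossing.
Qed.

Lemma conjugacy_classJ (G : groupType) (x g : G) :
  conjugacy_class (x ^ g)%g = conjugacy_class x.
Proof.
apply/seteqP; split=> _ [h _ <-].
  by exists (g * h)%g => //; rewrite conjgM.
by exists (g^-1 * h)%g => //; rewrite -conjgM mulVKg.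
Qed.

Lemma coded_conjugacy_class f g c : coded (ext f) (ext f^-1%g) c ->
  coded (ext g) (ext g^-1%g) c -> conjugacy_class f = conjugacy_class g.
Proof.
move=> fc gc.
have [h [h_lt h_surj h0 h1 hfg]] :=
  coded_conj (ext_aut f) (ext_aut g) (@ext_out _ f) (@ext_out _ g) fc gc.
have [k kP] := ext_surj h_lt h_surj h0 h1.
suff -> : f = (g ^ k)%g by rewrite conjugacy_classJ.
suff kf : (k * f = g * k)%g by rewrite conjgE -kf mulKg.
apply: ext_inj => x x01; rewrite !extM !kP ?hfg//.
by case/andP: x01 => x0 x1; rewrite -{1}(ext0 f) -{1}(ext_1 f) !(order_aut_le (ext_aut f)) x0.
Qed.

End generic_homeomorphisms.

(* Counting the conjugacy classes *)
Local Close Scope ring_scope.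

Theorem corollary1p4 (R : realType) :
  countable [set C : set (homeo01 R) | conjugacy_classes C /\ ~ haar_null R C].
Proof.
(* A class without a representative outside [bad] would be contained in that Haar null set. *)
have rep C : conjugacy_classes C -> ~ haar_null R C ->
    exists f : homeo01 R, ~ bad f /\ C = conjugacy_class f.
  move=> [x _ <-] nonnull; apply: contrapT => norep; apply: nonnull.
  exists (@bad R); first exact: borel_haar_null_bad.
  move=> _ [g _ <-]; apply: contrapT => nb; apply: norep.
  by exists (x ^ g)%g; rewrite conjugacy_classJ.
pose good_class c C :=
  exists f : homeo01 R, coded (ext f) (ext f^-1%g) c /\ C = conjugacy_class f.
have [D DP] : exists D, forall c C, good_class c C -> D c = C.
  (* A code determines at most one class; codes realized by no homeomorphism are sent to the empty
     set. *)
  have /choice[D DP] c : exists C, forall C', good_class c C' -> C = C'.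
    have [[C [f [fc _]]]|no] := pselect (exists C, good_class c C).
      by exists (conjugacy_class f) => _ [g [gc ->]]; exact: coded_conjugacy_class gc.
    by exists set0 => C' C'c; case: no; exists C'.
  by exists D => c C; exact: DP.
apply: sub_countable (countableP [set: option nat * option nat * bool]).
apply: card_le_trans (card_image_le D _).
apply: subset_card_le => C [Cclass nonnull].
have [f [nf Cf]] := rep C Cclass nonnull; have [c fc] := not_bad_coded nf.
by exists c => //; apply: DP; exists f.
Qed.
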